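(* Let $G$ be a graph with adjacency matrix $M$, let $T:V(G)\to V(G)$ be an automorphism of $G$ of order $r$, and let $K\subset V(G)$ be an orbit of $T$ of cardinality $r$. Let $d$ denote the largest distance between $K$ and any other node of $G$. If $r(d+1)>|V(G)|$, then $M^K=M+Q\cdot D_K$ exhibits pretty good fractional revival with respect to $K$ for any transcendental $Q\in\mathbb{R}$.
   Context: $D_K$ is the diagonal matrix with diagonal entries $1$ in $K$ and $0$ elsewhere. The distance between $K$ and a node is the minimum graph distance from that node to an element of $K$. A real symmetric matrix $N\in\mathbb{R}^{X\times X}$ exhibits pretty good fractional revival with respect to $K\subset X$ if the closure of $\{\exp(itN)_{K\times K}:t\ge0\}$ contains a unitary $K\times K$ matrix that is not a scalar multiple of the identity (equivalently, that has at least two distinct eigenvalues). Here $A_{K\times K}$ denotes the $K\times K$ submatrix of $A$. *)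

(* Defs.v *)
From HB Require Import structures.
From mathcomp Require Import all_boot all_order all_algebra all_fingroup.
From mathcomp Require Import all_classical all_reals all_analysis.
From mathcomp Require Import complex.
Set Implicit Arguments.
Unset Strict Implicit.
Unset Printing Implicit Defensive.
Import Order.TTheory GRing.Theory Num.Theory.
Import numFieldNormedType.Exports.
Local Open Scope classical_set_scope.
Local Open Scope ring_scope.
Local Open Scope complex_scope.

(* The topology of R[i] is that of its modulus, as for any numFieldType;
   matrices over R[i] then carry the entrywise (product) topology. *)
HB.instance Definition _ (R : realType) := NormedModule.copy R[i] R[i]^o.

(* A simple graph is a symmetric irreflexive relation e on a finType V.
   Matrices in R^(V x V) are represented in 'M_#|V| through the enumeration of
   V, and matrices in R^(K x K) in 'M_#|K| through the enumeration of K. *)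

Definition automorphism (V : finType) (e : rel V) (T : {perm V}) :=
  forall x y, e (T x) (T y) = e x y.

(* Distances are relations to nat: unreachable vertices have no distance. *)
Definition graph_dist (V : finType) (e : rel V) (x y : V) (n : nat) :=
  (exists p, [/\ path e x p, last x p = y & size p = n]) /\
  (forall p, path e x p -> last x p = y -> (n <= size p)%N).

Definition set_dist (V : finType) (e : rel V) (K : {set V}) (v : V) (n : nat) :=
  (exists2 x, x \in K & graph_dist e x v n) /\
  (forall x m, x \in K -> graph_dist e x v m -> (n <= m)%N).

(* Vertices of K are at distance 0 from K, so including them only matters when
   K is everything, in which case the largest distance is 0. *)
Definition largest_dist (V : finType) (e : rel V) (K : {set V}) (d : nat) :=
  (forall v, exists2 n, set_dist e K v n & (n <= d)%N) /\
  (exists v, set_dist e K v d).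

Definition adjmx (R : realType) (V : finType) (e : rel V) : 'M[R]_#|V| :=
  \matrix_(i, j) (e (enum_val i) (enum_val j))%:R.

Definition Dmx (R : realType) (V : finType) (K : {set V}) : 'M[R]_#|V| :=
  diag_mx (\row_i (enum_val i \in K)%:R).

Definition principal_submx (F : Type) (V : finType) (K : {set V})
    (A : 'M[F]_#|V|) : 'M[F]_#|K| :=
  \matrix_(i, j) A (enum_rank (enum_val i)) (enum_rank (enum_val j)).

Definition expmx (R : realType) (n : nat) (A : 'M[R[i]]_n) : 'M[R[i]]_n :=
  limn (series (fun k => (k`!%:R : R[i])^-1 *: A ^+ k)).

Definition pretty_good_fractional_revival (R : realType) (V : finType)
    (N : 'M[R]_#|V|) (K : {set V}) :=
  exists U : 'M[R[i]]_#|K|,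
    [/\ closure [set principal_submx K
                       (expmx (('i * t%:C) *: map_mx (real_complex R) N))
                | t in [set t : R | 0 <= t]] U,
        U \is unitarymx & ~~ is_scalar_mx U].

Definition transcendental (R : realType) (q : R) :=
  ~ algebraicOver (ratr : rat -> R) q.

(* Main.v *)
Require Import Defs.
From HB Require Import structures.
From mathcomp Require Import all_boot all_order all_algebra all_fingroup.
From mathcomp Require Import all_classical all_reals all_analysis.
From mathcomp Require Import complex.
From mathcomp Require Import separable zify ring lra.
Import Order.TTheory GRing.Theory Num.Theory.
Import numFieldNormedType.Exports.
Local Open Scope ring_scope.

(** Let [N = M + Q D_K] and let [w] be a primitive [r]-th root of unity.  For
    [k < r] let [y_k] be the row vector supported on [K] that takes the value
    [w ^ (k a)] at [T^a x0].  These vectors are orthogonal and span the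
    functions on [K]; because [T] commutes with [M] and [D_K], the cyclic space
    spanned by the [y_k M^j] consists of vectors on which [T] acts by [w ^ k],
    and [D_K] maps such a vector to a multiple of [y_k].  So on each of these
    spaces [N] is a rank one perturbation, depending linearly on [Q], of a
    matrix over the field [F] of algebraic numbers.

    Let [m_k] be the dimension of the cyclic space of [y_k].  The eigenvalues of
    [N] seen by [y_k] are the roots of [phi_k = p_k - Q q_k], where [p_k] is the
    minimal polynomial of [y_k] with respect to [M], of degree [m_k], and [q_k]
    is monic of degree [m_k - 1] and coprime to [p_k].  As [Q] is transcendental,
    [phi_k] is irreducible over [F(Q)] ([eigenvalue_degree_ge]), and its roots
    have sum [Q + c_k] with [c_k] in [F].  Applying the trace of a finite
    extension of [F(Q)], divided by its degree, to an integer relation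
    [sum_i l_i lambda_i = 0] between eigenvalues ([trace_relation]) and reading
    off the coefficient of [Q] gives [sum_i l_i / m_{k(i)} = 0]
    ([eigenvalue_relation]).  An eigenvalue may be seen by several [y_k], but
    [m_k] is then the same for all of them, being its degree over [F(Q)]
    ([eigenvalue_degree_unique]).

    By Kronecker's approximation theorem ([kronecker]) there are then times
    [t >= 0] at which every [exp(i t lambda)], for [lambda] seen by [y_k], is as
    close as desired to [exp(i / m_k)].  Hence the closure of the [K x K] blocks
    of [exp(i t N)] contains the unitary matrix that has the [y_k] as
    eigenvectors with eigenvalues [exp(i / m_k)] ([closure_evolution],
    [fourier_conjugate_unitary]).

    It remains to see that the [m_k] are not all equal, and this is where the
    inequality comes from.  Counting walks from [K] shows that [1_K M^j] for
    [j <= d] are independent, so [m_0 > d] ([indicator_annihilator_size]).  The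
    cyclic spaces of the different [y_k] are independent subspaces of a space of
    dimension [|V| < r (d + 1)], so some [m_k] is at most [d]
    ([exists_low_degree_annihilator]).  *)

Set Implicit Arguments.
Unset Strict Implicit.
Unset Printing Implicit Defensive.

(** * Traces and relations between algebraic elements *)

Lemma coefM_subleading (K : comNzRingType) (p q : {poly K}) m n :
    (size p <= m.+2)%N -> (size q <= n.+2)%N ->
  (p * q)`_(m + n).+1 = p`_m * q`_n.+1 + p`_m.+1 * q`_n.
Proof.
move=> sp sq; rewrite coefM.
have lt1 : (m < (m + n).+2)%N by lia.
have lt2 : (m.+1 < (m + n).+2)%N by lia.
rewrite (bigD1 (Ordinal lt1)) //= (bigD1 (Ordinal lt2)) /=; last first.
  by rewrite -val_eqE /=; apply/eqP; lia.
rewrite big1 ?addr0; last first.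
  move=> i /andP[]; rewrite -!val_eqE /= => ne1 ne2.
  have lti := ltn_ord i; have [lt_im|h] := ltnP i m.
    by rewrite [q`__]nth_default ?mulr0 //; apply: leq_trans sq _; lia.
  rewrite [p`__]nth_default ?mul0r //; apply: leq_trans sp _.
  by move/eqP: ne1; move/eqP: ne2; lia.
by rewrite subSS addKn -addnS addKn.
Qed.

Lemma exp_monic_subleading (K : comNzRingType) (p : {poly K}) m s :
    p \is monic -> size p = m.+2 ->
  (p ^+ s.+1)`_(s * m.+1 + m) = p`_m *+ s.+1.
Proof.
move=> mon_p sp; elim: s => [|s IHs]; first by rewrite mul0n expr1.
have mon_ps : p ^+ s.+1 \is monic by rewrite monic_exp.
have sps : size (p ^+ s.+1) = (s.+1 * m.+1).+1.
  rewrite {mon_ps IHs}; elim: (s.+1) => [|k IHk]; first by rewrite expr0 size_poly1.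
  by rewrite exprS size_Mmonic ?monic_exp ?monic_neq0 // IHk sp; lia.
rewrite exprS (_ : (s.+1 * _ + m = (m + (s * m.+1 + m)).+1)%N); last by lia.
rewrite coefM_subleading ?sp //; last by rewrite sps; lia.
have -> : (p ^+ s.+1)`_(s * m.+1 + m).+1 = 1.
  by rewrite -(monicP mon_ps) lead_coefE sps; congr (_`__); lia.
have -> : p`_m.+1 = 1 by rewrite -(monicP mon_p) lead_coefE sp.
by rewrite mulr1 mul1r IHs [in RHS]mulrS.
Qed.

Lemma eigenvector_horner_mx (K : comNzRingType) n (A : 'M[K]_n.+1) (v : 'rV_n.+1)
    (a : K) (p : {poly K}) :
  v *m A = a *: v -> v *m horner_mx A p = p.[a] *: v.
Proof.
move=> vA; elim/poly_ind: p => [|p c IHp]; first by rewrite rmorph0 mulmx0 horner0 scale0r.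
rewrite rmorphD rmorphM /= horner_mx_X horner_mx_C hornerMXaddC mulmxDr.
rewrite [_ * A]/(_ *m A) mulmxA IHp -scalemxAl vA scalerA scalerDl.
by rewrite mul_mx_scalar.
Qed.

Section Roots.
Variables (K : fieldType) (C : closedFieldType) (iota : {rmorphism K -> C}).

(** While [chi] has a root, that root is shared with [phi], so the irreducible
    [phi] divides [chi] and can be split off. *)
Lemma irreducible_power (phi chi : {poly K}) :
    phi \is monic -> irreducible_poly phi -> chi \is monic ->
    (forall x, root (map_poly iota chi) x -> root (map_poly iota phi) x) ->
  exists s, chi = phi ^+ s.
Proof.
move=> mon_phi irr_phi; have [k] := ubnP (size chi).
elim: k chi => // k IHk chi lt_chi mon_chi rt.
have [/eqP/size_poly1P[c nzc chiE]|s1] := eqVneq (size chi) 1%N.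
  exists 0; rewrite expr0; move: mon_chi.
  by rewrite chiE monicE lead_coefC => /eqP ->.
have /closed_rootP[x rx] : size (map_poly iota chi) != 1 by rewrite size_map_poly.
have phi_chi : phi %| chi.
  have [co|nco] := boolP (coprimep phi chi).
    have : coprimep (map_poly iota phi) (map_poly iota chi) by rewrite coprimep_map.
    by move/coprimep_root/(_ (rt _ rx)); rewrite (rootP rx) eqxx.
  by rewrite -(eqp_dvdl _ (irr_phi.2 _ nco (dvdp_gcdl _ _))) dvdp_gcdr.
have [chi' chiE] := dvdpP _ _ phi_chi.
have mon' : chi' \is monic by move: mon_chi; rewrite chiE monicMr.
have lt' : (size chi' < k)%N.
  rewrite chiE size_Mmonic ?monic_neq0 // in lt_chi.
  have := irr_phi.1; move: lt_chi; move: (size phi) (size chi') => u v; lia.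
have rt' y : root (map_poly iota chi') y -> root (map_poly iota phi) y.
  by move=> ry; apply: rt; rewrite chiE rmorphM rootM ry.
have [s chiE'] := IHk chi' lt' mon' rt'; exists s.+1.
by rewrite chiE chiE' exprSr.
Qed.

(** The characteristic polynomial of [A] is a power of [phi], and the subleading
    coefficient of a power of a monic polynomial is a multiple of that of the
    polynomial. *)
Lemma trace_annihilated n (A : 'M[K]_n.+1) (phi : {poly K}) m :
    phi \is monic -> irreducible_poly phi -> size phi = m.+2 ->
    horner_mx A phi = 0 ->
  (\tr A) *+ m.+1 = - (phi`_m *+ n.+1).
Proof.
move=> mon_phi irr_phi sphi A0.
have rt x : root (map_poly iota (char_poly A)) x -> root (map_poly iota phi) x.
  rewrite map_char_poly -eigenvalue_root_char => /eigenvalueP[v vA v0].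
  have := congr1 (map_mx iota) A0.
  rewrite map_horner_mx map_mx0 => /(congr1 (mulmx v)).
  rewrite (eigenvector_horner_mx _ vA) mulmx0 => /eqP.
  by rewrite scaler_eq0 (negPf v0) orbF.
have [s chiE] := irreducible_power mon_phi irr_phi (char_poly_monic A) rt.
have nE : n.+1 = (s * m.+1)%N.
  have := size_exp phi s; rewrite -chiE size_char_poly sphi /=; lia.
case: s nE chiE => // s nE chiE.
have := @char_poly_trace _ _ A (ltn0Sn n); rewrite chiE.
rewrite (_ : n.+1.-1 = s * m.+1 + m)%N; last by lia.
rewrite (exp_monic_subleading _ mon_phi sphi) => trE.
by rewrite -[\tr A]opprK -trE mulNrn -mulrnA -nE.
Qed.

Lemma minimal_poly_irreducible (phi : {poly K}) (x : C) :
    (1 < size phi)%N -> root (map_poly iota phi) x ->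
    (forall g, root (map_poly iota g) x -> (size g < size phi)%N -> g = 0) ->
  irreducible_poly phi.
Proof.
move=> s1 rx min; split=> // q sq /dvdpP[u phiE].
have nz_phi : phi != 0 by rewrite -size_poly_gt0 ltnW.
have [nz_u nz_q] : u != 0 /\ q != 0.
  by apply/andP; rewrite -negb_or -mulf_eq0 -phiE.
rewrite phiE rmorphM rootM in rx.
have su : size phi = (size u + size q).-1 by rewrite phiE size_mul.
have [su_gt0 sq_gt0] : (0 < size u /\ 0 < size q)%N by rewrite !size_poly_gt0.
rewrite -dvdp_size_eqp ?su; last by rewrite phiE dvdp_mulIr.
case/orP: rx => /min min0; last first.
  have lt : (size q < size phi)%N \/ size u = 1%N.
    by rewrite su; move: (size q) (size u) sq su_gt0 => a b /eqP; lia.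
  case: lt => [/min0/eqP|->]; first by rewrite (negPf nz_q).
  by rewrite add1n.
have lt : (size u < size phi)%N.
  by rewrite su; move: (size q) (size u) sq sq_gt0 su_gt0 => a b /eqP; lia.
by rewrite min0 ?eqxx in nz_u.
Qed.

Lemma exists_minimal_poly (x : C) : algebraicOver iota x ->
  exists2 psi : {poly K}, psi \is monic /\ (1 < size psi)%N
    & forall g, root (map_poly iota g) x = (psi %| g).
Proof.
case=> p; have [k] := ubnP (size p).
elim: k p => // k IHk p lt_p nz_p rp.
have [[g [[rg lt_g] nz_g]]|nex] := pselect
    (exists g, (root (map_poly iota g) x /\ (size g < size p)%N) /\ g != 0).
  by apply: IHk rg => //; apply: leq_trans lt_g _.
have min g : root (map_poly iota g) x -> (size g < size p)%N -> g = 0.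
  by move=> rg lt_g; apply/eqP; apply: contraT => nz_g; case: nex; exists g.
pose psi := (lead_coef p)^-1 *: p.
have nz_lp : (lead_coef p)^-1 != 0 by rewrite invr_eq0 lead_coef_eq0.
have mon_psi : psi \is monic by rewrite monicE lead_coefZ mulVf // lead_coef_eq0.
have s_psi : size psi = size p by rewrite size_scale.
have r_psi : root (map_poly iota psi) x.
  by rewrite rootE map_polyZ hornerZ (rootP rp) mulr0.
exists psi.
  split=> //; rewrite ltnNge s_psi; apply/negP => /size1_polyC pE.
  by move: rp; rewrite pE map_polyC rootC fmorph_eq0 -polyC_eq0 -pE (negPf nz_p).
move=> g; apply/idP/idP => [rg|/dvdpP[u ->]]; last by rewrite rmorphM rootM r_psi orbT.
apply/eqP/min; last by rewrite -s_psi ltn_modp monic_neq0.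
have := rg; rewrite {1}(divp_eq g psi) rmorphD rmorphM /= !rootE !hornerE.
by rewrite (rootP r_psi) mulr0 add0r.
Qed.

Hypothesis charK : [pchar K] =i pred0.

Lemma primitive_element (I : finType) (theta : I -> C) :
    (forall i, algebraicOver iota (theta i)) ->
  exists2 z, algebraicOver iota z
    & forall i, exists h, (map_poly iota h).[z] = theta i.
Proof.
move=> alg.
suff [z alg_z hz] : exists2 z, algebraicOver iota z
    & forall i, i \in enum I -> exists h, (map_poly iota h).[z] = theta i.
  by exists z => // i; apply: hz; rewrite mem_enum.
elim: (enum I) => [|j s [z alg_z hz]]; first by exists 0; [exact: algebraic0|].
case: (alg_z) (alg j) => p nz_p pz [q nz_q qj].
have [n [[a za] [b zb]]] := pchar0_PET nz_p pz nz_q qj charK.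
exists (theta j *+ n - z).
  apply: algebraic_sub => //; rewrite -mulr_natr; apply: algebraic_mul; first by exists q.
  by rewrite -(rmorph_nat iota); apply: algebraic_id.
move=> i; rewrite inE => /predU1P[->|/hz[h <-]]; first by exists b.
by exists (h \Po a); rewrite map_comp_poly horner_comp za.
Qed.

(** The normalized trace to [K] of a common extension containing all the
    [theta i] is additive and maps [theta i] to minus the quotient of the
    subleading coefficient of its minimal polynomial by the degree.  The
    extension is generated by a primitive element [z], so the trace can be
    computed with matrices: [theta i] is a polynomial in [z], hence acts as the
    same polynomial in the companion matrix of the minimal polynomial of [z].
    The degree of [phi i] is [(m i).+1]. *)
Lemma trace_relation (I : finType) (theta : I -> C) (phi : I -> {poly K})
    (m : I -> nat) (l : I -> int) :
    (forall i, phi i \is monic) -> (forall i, size (phi i) = (m i).+2) ->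
    (forall i, root (map_poly iota (phi i)) (theta i)) ->
    (forall i g, root (map_poly iota g) (theta i) ->
                 (size g < size (phi i))%N -> g = 0) ->
    \sum_i (theta i) *~ l i = 0 ->
  \sum_i ((phi i)`_(m i) / (m i).+1%:R) *~ l i = 0.
Proof.
move=> mon sz rt min rel.
have [|z alg_z hz] := @primitive_element I theta.
  by move=> i; exists (phi i); rewrite ?monic_neq0.
have [psi [mon_psi spsi] psiP] := exists_minimal_poly alg_z.
have {hz}/fin_all_exists[h hE] := hz.
have [n sz_psi] : exists n, size psi = n.+2.
  by exists (size psi).-2; move: spsi; case: (size psi) => [|[]].
(* casts the companion matrix to a dimension that is visibly positive *)
have : exists2 B : 'M[K]_n.+1, forall g, psi %| g -> horner_mx B g = 0 & true.
  have : exists2 B : 'M[K]_n.+1, char_poly B = psi & true.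
    move: (companionmx psi) (companionmxK mon_psi).
    by rewrite sz_psi => B cB; exists B.
  case=> B cB _; exists B => // g /dvdpP[u ->].
  by rewrite rmorphM /= -[in X in _ * horner_mx _ X]cB Cayley_Hamilton mulr0.
case=> B B0 _.
have nchar k : (k.+1%:R : K) != 0 by move/pcharf0P: charK => ->.
have trE i : \tr (horner_mx B (h i)) = - n.+1%:R * ((phi i)`_(m i) / (m i).+1%:R).
  have := @trace_annihilated n (horner_mx B (h i)) (phi i) (m i) (mon i) _ (sz i).
  have -> : horner_mx (horner_mx B (h i)) (phi i) = horner_mx B (phi i \Po h i).
    elim/poly_ind: (phi i) => [|p c IHp]; first by rewrite comp_poly0 !rmorph0.
    by rewrite comp_polyD comp_polyM comp_polyX comp_polyC !rmorphD !rmorphM /= IHp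
       horner_mx_X !horner_mx_C.
  rewrite B0; last by rewrite -psiP map_comp_poly rootE horner_comp hE; exact: rt.
  have irr : irreducible_poly (phi i).
    by apply: (@minimal_poly_irreducible _ (theta i)) (rt i) (min i); rewrite sz.
  move=> /(_ irr erefl); rewrite -[LHS]mulr_natr -[X in _ = - X]mulr_natr => trE.
  apply: (mulIf (nchar (m i))); rewrite trE mulrA divfK //.
  by rewrite mulNr mulrC.
have : \tr (horner_mx B (\sum_i h i *~ l i)) = 0.
  rewrite B0 ?mxtrace0 // -psiP rootE rmorph_sum horner_sum /=.
  rewrite -[X in _ == X]rel; apply/eqP/eq_bigr => i _.
  by rewrite rmorphMz /= -scaler_int hornerZ hE mulrzl.
rewrite rmorph_sum raddf_sum /= => tr0.
apply/(mulfI (x := - n.+1%:R)); first by rewrite oppr_eq0 nchar.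
rewrite mulr0 -[RHS]tr0 mulr_sumr; apply: eq_bigr => i _.
by rewrite rmorphMz /= raddfMz /= trE mulrzAr.
Qed.
End Roots.

(** * Subfields and rational functions of a transcendental number *)

Section SubfieldOf.
Variables (C : fieldType) (S : divringClosed C).

(** Fields between a small field and [C] are needed as types in their own right,
    since traces and characteristic polynomials are taken over them. *)
Record subfield_of := SubfieldOf { subfield_val : C; _ : subfield_val \in S }.

HB.instance Definition _ := [isSub for subfield_val].
HB.instance Definition _ := [Choice of subfield_of by <:].
HB.instance Definition _ := [SubChoice_isSubComUnitRing of subfield_of by <:].
HB.instance Definition _ :=
  [SubComUnitRing_isSubIntegralDomain of subfield_of by <:].
HB.instance Definition _ := [SubIntegralDomain_isSubField of subfield_of by <:].
End SubfieldOf.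

Lemma exists_subfield (C : fieldType) (P : C -> Prop) :
    P 1 -> (forall x y, P x -> P y -> P (x - y)) ->
    (forall x y, P x -> P y -> P (x / y)) ->
  exists (F : fieldType) (iota : {rmorphism F -> C}),
    (forall a, P (iota a)) /\ (forall x, P x -> exists a, iota a = x).
Proof.
move=> P1 PB PV; pose S := [pred x | `[< P x >]].
have clS : divring_closed S.
  split=> [|x y|x y]; rewrite ![_ \in S]unfold_in /=; first exact/asboolP.
    by move=> /asboolP Px /asboolP Py; apply/asboolP/PB.
  by move=> /asboolP Px /asboolP Py; apply/asboolP/PV.
pose T : divringClosed C := HB.pack (S : {pred C}) (GRing.isDivringClosed.Build C S clS).
exists (subfield_of T), (val : {rmorphism subfield_of T -> C}).
split=> [[x /= Sx]|x /asboolP Px]; first exact/asboolP.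
by exists (SubfieldOf (Px : x \in T)).
Qed.

Section FunctionField.
Variables (F C : fieldType) (iota : {rmorphism F -> C}) (Q : C).
Hypothesis Q_tr : ~ algebraicOver iota Q.

(** Modulo [p] only the term [g 0 * q ^ (s - 1)] survives; as [q] is invertible
    modulo [p] and [g 0] has smaller degree than [p], [g 0 = 0].  Cancelling [p]
    shifts the remaining coefficients. *)
Lemma homogeneous_coprime_sum (p q : {poly F}) (g : nat -> {poly F}) s :
    coprimep p q -> (forall i, (size (g i) < size p)%N) ->
    \sum_(i < s) g i * p ^+ i * q ^+ (s.-1 - i) = 0 ->
  forall i, (i < s)%N -> g i = 0.
Proof.
move=> co; elim: s g => [//|s IHs] g sg; rewrite big_ord_recl /= expr0 mulr1 subn0 => sum0.
have g0 : g 0 = 0.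
  apply/eqP; apply: contraT => nz.
  have : p %| g 0 * q ^+ s.
    have -> : g 0 * q ^+ s = - (\sum_(i < s) g i.+1 * p ^+ i * q ^+ (s.-1 - i)) * p.
      apply/eqP; rewrite mulNr -addr_eq0 -[X in _ == X]sum0 mulr_suml; apply/eqP.
      congr (_ + _); apply: eq_bigr => i _; rewrite /bump /= add1n exprSr.
      by rewrite mulrA [RHS]mulrAC (_ : s - i.+1 = s.-1 - i)%N //; lia.
    by rewrite dvdp_mull.
  rewrite Gauss_dvdpl; last by apply: coprimep_expr.
  by move/(dvdp_leq nz); rewrite leqNgt sg.
have nz_p : p != 0 by rewrite -size_poly_gt0 (leq_ltn_trans _ (sg 0%N)).
case=> [//|i] lt_i; apply: (IHs (fun k => g k.+1)) => // {i lt_i}.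
apply: (mulIf nz_p); rewrite mul0r mulr_suml -[RHS]sum0 g0 mul0r add0r.
apply: eq_bigr => j _; rewrite /bump /= add1n exprSr.
by rewrite mulrA mulrAC (_ : s - j.+1 = s.-1 - j)%N //; lia.
Qed.

Variables (p q : {poly F}) (lambda : C).
Hypothesis co_pq : coprimep p q.
Hypothesis lambdaE : (map_poly iota p).[lambda] = Q * (map_poly iota q).[lambda].

Lemma denominator_neq0 : (map_poly iota q).[lambda] != 0.
Proof.
apply/eqP => q0; have : coprimep (map_poly iota p) (map_poly iota q) by rewrite coprimep_map.
move=> /coprimep_root co; have /co : root (map_poly iota p) lambda.
  by rewrite rootE lambdaE q0 mulr0.
by rewrite q0 eqxx.
Qed.

(** Otherwise [Q = p(lambda) / q(lambda)] would be algebraic over [F]. *)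
Lemma eigenvalue_transcendental : ~ algebraicOver iota lambda.
Proof.
have alg (u : {poly F}) : algebraicOver iota lambda -> algebraicOver iota (map_poly iota u).[lambda].
  move=> alg; apply/integral_algebraic/integral_horner.
    by apply/integral_poly => i; rewrite coef_map; apply: integral_id.
  exact/integral_algebraic.
move=> alg_l; apply: Q_tr.
have -> : Q = (map_poly iota p).[lambda] / (map_poly iota q).[lambda].
  by rewrite lambdaE mulfK ?denominator_neq0.
by apply: algebraic_div; apply: alg.
Qed.

(** Substituting [Q = p(lambda) / q(lambda)] and clearing denominators turns the
    relation into a polynomial relation over [F] for the transcendental
    [lambda], so that it holds identically. *)
Lemma bivariate_relation_trivial (s : nat) (g : nat -> {poly F}) :
    (forall j, (size (g j) < size p)%N) ->
    \sum_(j < s) (map_poly iota (g j)).[lambda] * Q ^+ j = 0 ->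
  forall j, (j < s)%N -> g j = 0.
Proof.
move=> sg rel; apply: (homogeneous_coprime_sum co_pq sg).
apply/eqP; apply: contraT => nz; case: eigenvalue_transcendental.
eexists; first exact: nz.
rewrite rootE rmorph_sum horner_sum /=; apply/eqP.
transitivity ((map_poly iota q).[lambda] ^+ s.-1 *
    \sum_(j < s) (map_poly iota (g j)).[lambda] * Q ^+ j); last by rewrite rel mulr0.
rewrite mulr_sumr.
apply: eq_bigr => i _; rewrite !rmorphM !rmorphXn /= !hornerM !horner_exp lambdaE.
rewrite exprMn -!mulrA [RHS]mulrCA; congr (_ * _); rewrite [RHS]mulrC; congr (_ * _).
by rewrite -exprD subnKC //; have := ltn_ord i; lia.
Qed.

Variables (K : fieldType) (kappa : {rmorphism K -> C}).
Hypothesis K_ratio : forall a, exists P D : {poly F},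
  (map_poly iota D).[Q] != 0 /\ kappa a * (map_poly iota D).[Q] = (map_poly iota P).[Q].

(** The fraction field [K] of [F[Q]] is known only through its elements being
    quotients of polynomials in [Q].  After clearing denominators, a relation
    for [lambda] over [K] becomes a relation in [lambda] and [Q] over [F]; its
    degree in [lambda] is unchanged, and it is sorted by powers of [Q]. *)
Lemma eigenvalue_degree_ge (g : {poly K}) :
  root (map_poly kappa g) lambda -> (size g < size p)%N -> g = 0.
Proof.
move=> rg sg.
have /fin_all_exists[PD PDE] : forall i : 'I_(size g), exists PD : {poly F} * {poly F},
  (map_poly iota PD.2).[Q] != 0 /\ kappa g`_i * (map_poly iota PD.2).[Q] = (map_poly iota PD.1).[Q].
  by move=> i; have [P [D PDE]] := K_ratio g`_i; exists (P, D).
pose den := \prod_i (PD i).2.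
pose num i := (PD i).1 * \prod_(j | j != i) (PD j).2.
have den0 : (map_poly iota den).[Q] != 0.
  rewrite rmorph_prod horner_prod; apply/prodf_neq0 => i _; exact: (PDE i).1.
have numE i : (map_poly iota (num i)).[Q] = kappa g`_i * (map_poly iota den).[Q].
  rewrite /num [den](bigD1 i) //= !rmorphM /= !hornerM mulrA; congr (_ * _).
  by rewrite (PDE i).2.
(* [G j] collects the coefficients of [Q ^ j] as a polynomial in [lambda] *)
pose s := \max_i size (num i).
pose G j := \poly_(i < size g) (if insub i is Some k then (num k)`_j else 0).
have GE (i : 'I_(size g)) j : (G j)`_i = (num i)`_j.
  rewrite coef_poly ltn_ord; case: insubP => [k _ /val_inj -> //|].
  by rewrite ltn_ord.
have num_wide (i : 'I_(size g)) : (map_poly iota (num i)).[Q] = \sum_(j < s) iota (num i)`_j * Q ^+ j.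
  rewrite (@horner_coef_wide _ s) ?size_map_poly ?leq_bigmax //.
  by apply: eq_bigr => j _; rewrite coef_map.
have G0 : forall j, (j < s)%N -> G j = 0.
  apply: bivariate_relation_trivial => [j|].
    by apply: leq_ltn_trans sg; apply: size_poly.
  have : \sum_(i < size g) (map_poly iota (num i)).[Q] * lambda ^+ i = 0.
    transitivity ((map_poly kappa g).[lambda] * (map_poly iota den).[Q]); last first.
      by rewrite (rootP rg) mul0r.
    rewrite horner_coef size_map_poly mulr_suml; apply: eq_bigr => i _.
    by rewrite numE coef_map mulrAC.
  move=> rel; rewrite -[RHS]rel.
  have rw (j : 'I_s) : (map_poly iota (G j)).[lambda] * Q ^+ j =
      \sum_(i < size g) (map_poly iota (G j))`_i * lambda ^+ i * Q ^+ j.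
    by rewrite (@horner_coef_wide _ (size g)) ?mulr_suml // size_map_poly size_poly.
  rewrite (eq_bigr _ (fun j _ => rw j)) exchange_big; apply: eq_bigr => i _ /=.
  rewrite num_wide mulr_suml; apply: eq_bigr => j _.
  by rewrite coef_map /= GE mulrAC.
apply/polyP => i; rewrite coef0; have [lti|] := ltnP i (size g); last exact: nth_default.
apply/eqP; rewrite -(fmorph_eq0 kappa) -(mulIr_eq0 _ (mulIf den0)).
rewrite -(numE (Ordinal lti)) num_wide big1 // => j _.
by rewrite -GE G0 ?coef0 ?rmorph0 ?mul0r.
Qed.
End FunctionField.

Lemma exists_function_field (F C : fieldType) (iota : {rmorphism F -> C}) (Q : C) :
  exists (K : fieldType) (kappa : {rmorphism K -> C}),
    [/\ forall a, exists P D : {poly F}, (map_poly iota D).[Q] != 0 /\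
          kappa a * (map_poly iota D).[Q] = (map_poly iota P).[Q],
        exists a, kappa a = Q & forall b, exists a, kappa a = iota b].
Proof.
pose P x := exists N D : {poly F}, (map_poly iota D).[Q] != 0 /\
          x * (map_poly iota D).[Q] = (map_poly iota N).[Q].
have [|||K [kappa [Pk kP]]] := @exists_subfield C P.
- by exists 1, 1; rewrite !rmorph1 !hornerE oner_eq0.
- move=> x y [a [b [b0 ab]]] [c [d [d0 cd]]]; exists (a * d - c * b), (b * d).
  rewrite rmorphB !rmorphM /= !(hornerM, hornerD, hornerN) mulf_neq0 //; split=> //.
  by rewrite -ab -cd; ring.
- move=> x y [a [b [b0 ab]]] [c [d [d0 cd]]].
  have [->|y0] := eqVneq y 0.
    by exists 0, 1; rewrite invr0 mulr0 rmorph0 rmorph1 !hornerE oner_eq0.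
  exists (a * d), (b * c); rewrite !rmorphM /= !hornerM -ab -cd !mulf_neq0 //.
  by split=> //; field.
exists K, kappa; split=> //.
- by apply: kP; exists 'X, 1; rewrite map_polyX rmorph1 hornerX hornerC oner_eq0 mulr1; split.
- by move=> b; apply: kP; exists b%:P, 1; rewrite map_polyC map_polyC /= hornerC hornerC rmorph1 oner_eq0 mulr1; split.
Qed.

(** * Cyclic spaces and rank one pencils *)

Lemma exists_linear_dependence (F : fieldType) (I : finType) n (u : I -> 'rV[F]_n) :
    (n < #|I|)%N ->
  exists2 c : I -> F, exists i, c i != 0 & \sum_i c i *: u i = 0.
Proof.
move=> lt_n; pose A := \matrix_(k < #|I|) u (enum_val k).
have /rowV0Pn[w /sub_kermxP wA nz_w] : kermx A != 0.
  rewrite kermx_eq0; apply/negP => /eqP rk.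
  by have := rank_leq_col A; rewrite rk leqNgt lt_n.
exists (fun i => w 0 (enum_rank i)).
  have [k wk] : exists k, w 0 k != 0 by apply/rV0Pn.
  by exists (enum_val k); rewrite enum_valK.
rewrite -[RHS]wA mulmx_sum_row (reindex_onto enum_rank enum_val) => [|k _]; last exact: enum_valK.
apply: eq_big => [i|i _]; first by rewrite enum_rankK eqxx.
by rewrite rowK enum_rankK.
Qed.

Section Krylov.
Variables (F : fieldType) (n : nat) (M : 'M[F]_n) (y : 'rV[F]_n).
Implicit Types g p h : {poly F}.

(** The vector [y g(M)], written as a sum so as to make sense in dimension zero as
    well, where square matrices do not form a nontrivial ring in which [g] could
    be evaluated. *)
Definition krylov (g : {poly F}) := \sum_(i < size g) g`_i *: (y *m M ^+ i).

Lemma krylov_wide k g : (size g <= k)%N -> krylov g = \sum_(i < k) g`_i *: (y *m M ^+ i).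
Proof.
move=> sg; rewrite /krylov (big_ord_widen _ (fun i => g`_i *: (y *m M ^+ i)) sg) big_mkcond.
apply: eq_bigr => i _; case: ltnP => // ?; by rewrite nth_default ?scale0r.
Qed.

Lemma krylov_is_linear : linear krylov.
Proof.
move=> a g h; pose k := maxn (size (a *: g + h)) (maxn (size g) (size h)).
rewrite !(@krylov_wide k) ?leq_max ?leqnn ?orbT // scaler_sumr -big_split.
by apply: eq_bigr => i _; rewrite /= coefD coefZ scalerDl scalerA.
Qed.
HB.instance Definition _ := GRing.isLinear.Build F {poly F} 'rV[F]_n *:%R krylov krylov_is_linear.

Lemma krylovC c : krylov c%:P = c *: y.
Proof. by rewrite (@krylov_wide 1) ?size_polyC_leq1 // big_ord1 coefC /= expr0 mulmx1. Qed.

Lemma krylovMX g : krylov (g * 'X) = krylov g *m M.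
Proof.
rewrite (@krylov_wide (size g).+1); last first.
  by apply: leq_trans (size_polyMleq _ _) _; rewrite size_polyX addn2.
rewrite big_ord_recl coefMX /= scale0r add0r mulmx_suml; apply: eq_bigr => i _.
by rewrite coefMX /= -scalemxAl -mulmxA exprSr.
Qed.

(** The cyclic space of [y] has dimension [m.+1], which is the degree of [p]. *)
Definition minimal_annihilator p m := [/\ p \is monic, size p = m.+2, krylov p = 0 &
  forall g, krylov g = 0 -> (size g < size p)%N -> g = 0].

Lemma exists_minimal_annihilator : y != 0 ->
  exists pm : {poly F} * nat, minimal_annihilator pm.1 pm.2.
Proof.
move=> nz_y; have [|c [i nz_c] c0] := @exists_linear_dependence F 'I_n.+1 n (fun i => y *m M ^+ i).
  by rewrite card_ord.
have [g [nz_g g0]] : exists g : {poly F}, g != 0 /\ krylov g = 0.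
  exists (\poly_(j < n.+1) c (inord j)); split.
    apply: contraNneq nz_c => /(congr1 (fun g : {poly F} => g`_i)).
    by rewrite coef_poly ltn_ord inord_val coef0 => ->.
  rewrite (@krylov_wide n.+1) ?size_poly // -[RHS]c0; apply: eq_bigr => j _.
  by rewrite coef_poly ltn_ord inord_val.
have [k] := ubnP (size g); elim: k g nz_g g0 {c i nz_c c0} => // k IHk g nz_g g0 lt_g.
have [[h [h0 lt_h nz_h]]|nex] := pselect (exists h : {poly F},
   [/\ krylov h = 0, (size h < size g)%N & h != 0]).
  by apply: IHk h0 _ => //; apply: leq_trans lt_h _.
have min h : krylov h = 0 -> (size h < size g)%N -> h = 0.
  by move=> h0 lt_h; apply/eqP; apply: contraT => nz_h; case: nex; exists h.
have nz_lg : lead_coef g != 0 by rewrite lead_coef_eq0.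
have sz : size ((lead_coef g)^-1 *: g) = size g by rewrite size_scale ?invr_eq0.
have s1 : (1 < size g)%N.
  rewrite ltnNge; apply/negP => /size1_polyC gE.
  move: g0 nz_g; rewrite gE krylovC polyC_eq0 => /eqP.
  by rewrite scaler_eq0 (negPf nz_y) orbF => ->.
exists ((lead_coef g)^-1 *: g, (size g).-2); split; rewrite /= ?sz //.
- by rewrite monicE lead_coefZ mulVf.
- by case: (size g) s1 => [|[]].
- by rewrite linearZ /= g0 scaler0.
Qed.

Section Pencil.
Variables (a0 : 'I_n).
Hypothesis y_a0 : y 0 a0 = 1.

(** Writing [L] for the [a0]-th coordinate, this is the linear map sending [X^j]
    to the sum of [L(y M^i) X^(j-1-i)] over [i < j]; equivalently, [L] applied to
    the divided difference [(g(X) - g(Y)) / (X - Y)] with [Y^i] read as [y M^i]. *)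
Definition pencil_poly (g : {poly F}) :=
  \poly_(k < (size g).-1) krylov (drop_poly k.+1 g) 0 a0.

Lemma coef_pencil g k : (pencil_poly g)`_k = krylov (drop_poly k.+1 g) 0 a0.
Proof.
rewrite coef_poly; case: ltnP => // le_k.
rewrite (_ : drop_poly k.+1 g = 0) ?raddf0 ?mxE //.
by apply/eqP; rewrite -size_poly_eq0 size_drop_poly subn_eq0 -ltnS; case: (size g) le_k.
Qed.

Lemma size_pencil g : (size (pencil_poly g) <= (size g).-1)%N.
Proof. exact: size_poly. Qed.

Lemma pencil_subleading m p : p \is monic -> size p = m.+2 -> (pencil_poly p)`_m = 1.
Proof.
move=> mon_p sp; rewrite coef_pencil (_ : drop_poly _ _ = 1%:P).
  by rewrite krylovC scale1r.
apply/polyP => i; rewrite coef_drop_poly coefC; case: i => [|i] /=.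
  by rewrite -(monicP mon_p) lead_coefE sp.
by rewrite nth_default // sp; lia.
Qed.

Lemma pencil_is_linear : linear pencil_poly.
Proof.
move=> a g h; apply/polyP => k; rewrite coefD coefZ !coef_pencil.
by rewrite !linearP /= !mxE.
Qed.
HB.instance Definition _ :=
  GRing.isLinear.Build F {poly F} {poly F} *:%R pencil_poly pencil_is_linear.

Lemma pencilC c : pencil_poly c%:P = 0.
Proof.
by apply/eqP; rewrite -size_poly_leq0 (leq_trans (size_pencil _)) // size_polyC; case: (_ == _).
Qed.

Lemma pencilMX g : pencil_poly (g * 'X) = pencil_poly g * 'X + (krylov g 0 a0)%:P.
Proof.
apply/polyP => -[|k]; rewrite coefD coefMX coefC coef_pencil /= ?addr0 ?add0r.
  by congr (krylov _ _ _); apply/polyP => i; rewrite coef_drop_poly coefMX addn1.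
rewrite coef_pencil; congr (krylov _ _ _); apply/polyP => i.
by rewrite !coef_drop_poly coefMX addnS.
Qed.

(** The divided difference of [p] at a root [a] is the cofactor [h]. *)
Lemma pencil_root p h a : p = h * ('X - a%:P) -> (pencil_poly p).[a] = krylov h 0 a0.
Proof.
move=> ->; rewrite mulrBr mulrC [h * a%:P]mulrC mul_polyC linearB linearZ /=.
by rewrite mulrC pencilMX !hornerE mulrC; ring.
Qed.

Variables (D : 'M[F]_n) (C : fieldType) (iota : {rmorphism F -> C}).
Hypothesis krylovD : forall g, krylov g *m D = (krylov g 0 a0) *: y.

(** Pushing [y M^j M = y M^j (M + Q D) - Q L(y M^j) y] onto an eigenvector [v]
    expresses all [y M^j v] through [y v], by induction on the degree. *)
Lemma krylov_eigenvector (Q lambda : C) (v : 'cV[C]_n) (g : {poly F}) :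
    (map_mx iota M + Q *: map_mx iota D) *m v = lambda *: v ->
  map_mx iota (krylov g) *m v =
    ((map_poly iota g).[lambda] - Q * (map_poly iota (pencil_poly g)).[lambda])
      *: (map_mx iota y *m v).
Proof.
move=> Nv; have Mv : map_mx iota M *m v = lambda *: v - Q *: (map_mx iota D *m v).
  by rewrite -Nv mulmxDl -scalemxAl addrK.
elim/poly_ind: g => [|g c IHg].
  by rewrite !raddf0 !horner0 mulr0 subr0 scale0r mul0mx.
have -> : krylov (g * 'X + c%:P) = krylov g *m M + c *: y.
  by rewrite linearD /= krylovMX krylovC.
have -> : pencil_poly (g * 'X + c%:P) = pencil_poly g * 'X + (krylov g 0 a0)%:P.
  by rewrite linearD /= pencilMX pencilC addr0.
rewrite map_mxD map_mxM map_mxZ mulmxDl -mulmxA Mv mulmxBr -!scalemxAr -scalemxAl.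
rewrite mulmxA -map_mxM krylovD map_mxZ -scalemxAl IHg.
rewrite !rmorphD !rmorphM /= !map_polyX !map_polyC !hornerE /=.
rewrite !scalerA -scalerBl -scalerDl; congr (_ *: _); ring.
Qed.
End Pencil.
End Krylov.

(** A common root [a] of [p] and its pencil polynomial lies in [F], and the
    cofactor [h] of [p] at [a] gives an eigenvector [y h(M)] of [M] whose [a0]-th
    coordinate is zero.  Such a vector vanishes, against the minimality of [p]. *)
Lemma pencil_coprime (F : fieldType) (C : closedFieldType) (iota : {rmorphism F -> C})
    n (M : 'M[F]_n) (y : 'rV[F]_n) (a0 : 'I_n) (p : {poly F}) m :
    (forall x, algebraicOver iota x -> exists a, iota a = x) ->
    minimal_annihilator M y p m ->
    (forall h a, krylov M y h *m M = a *: krylov M y h -> krylov M y h 0 a0 = 0 ->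
      krylov M y h = 0) ->
  coprimep p (pencil_poly M y a0 p).
Proof.
move=> F_closed [mon_p _ p0 min] nondeg; rewrite /coprimep.
have nz_p := monic_neq0 mon_p.
have [//|sg] := eqVneq (size (gcdp p (pencil_poly M y a0 p))) 1%N.
have /closed_rootP[x] : size (map_poly iota (gcdp p (pencil_poly M y a0 p))) != 1.
  by rewrite size_map_poly.
move=> rx; have [a aE] : exists a, iota a = x.
  apply: F_closed; exists (gcdp p (pencil_poly M y a0 p)) => //.
  by rewrite gcdp_eq0 (negPf nz_p).
have : root (gcdp p (pencil_poly M y a0 p)) a by rewrite -(fmorph_root iota) aE.
rewrite root_gcd => /andP[/factor_theorem[h pE] /rootP qa].
rewrite (pencil_root _ _ _ pE) in qa.
have hM : krylov M y h *m M = a *: krylov M y h.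
  apply/eqP; rewrite -subr_eq0 -krylovMX -linearZ -linearB /=.
  by rewrite -mul_polyC [a%:P * h]mulrC -mulrBr -pE p0.
have nz_h : h != 0 by apply: contraNneq nz_p => h0; rewrite pE h0 mul0r.
have sp : size p = (size h).+1.
  by rewrite pE size_Mmonic ?monicXsubC // size_XsubC addn2.
have h0 : h = 0 by apply: min; [apply: nondeg hM qa | rewrite sp].
by rewrite h0 eqxx in nz_h.
Qed.

(** * Eigenvalues of a rank one pencil *)

Lemma exists_map_poly (K C : fieldType) (kappa : {rmorphism K -> C}) (P : {poly C}) :
    (forall i, exists a, kappa a = P`_i) ->
  exists g, map_poly kappa g = P.
Proof.
move=> /choice[a aE]; exists (\poly_(i < size P) a i).
apply/polyP => i; rewrite coef_map coef_poly; case: ltnP => [_|h]; first exact: aE.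
by rewrite raddf0 nth_default.
Qed.

Section PencilEigenvalues.
Variables (F : fieldType) (C : closedFieldType) (iota : {rmorphism F -> C}) (Q : C).
Hypothesis Q_tr : ~ algebraicOver iota Q.
Hypothesis F_closed : forall x, algebraicOver iota x -> exists a, iota a = x.
Hypothesis charF : [pchar F] =i pred0.
Variables (n : nat) (M D : 'M[F]_n) (a0 : 'I_n).

(** The spectral support of [y]: eigenvectors orthogonal to [y] do not count. *)
Definition visible_eigenvalue (y : 'rV[F]_n) (lambda : C) :=
  exists2 v : 'cV[C]_n,
    (map_mx iota M + Q *: map_mx iota D) *m v = lambda *: v & map_mx iota y *m v != 0.

(** These conditions make [M + Q D] a rank one perturbation of [M] on the cyclic
    space of [y].  The last one, a form of controllability, excludes eigenvalues
    that do not move with [Q]. *)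
Definition rank_one_cyclic (y : 'rV[F]_n) := [/\ y 0 a0 = 1,
  forall g, krylov M y g *m D = krylov M y g 0 a0 *: y &
  forall h a, krylov M y h *m M = a *: krylov M y h -> krylov M y h 0 a0 = 0 ->
      krylov M y h = 0].

Lemma rank_one_cyclic_neq0 y : rank_one_cyclic y -> y != 0.
Proof. by case=> y1 _ _; apply: contra_eq_neq y1 => ->; rewrite mxE eq_sym oner_eq0. Qed.

Section OverFunctionField.
Variables (K : fieldType) (kappa : {rmorphism K -> C}).
Hypothesis K_ratio : forall a, exists P D : {poly F},
  (map_poly iota D).[Q] != 0 /\ kappa a * (map_poly iota D).[Q] = (map_poly iota P).[Q].
Hypothesis K_Q : exists a, kappa a = Q.
Hypothesis K_F : forall b, exists a, kappa a = iota b.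

(** One and the same polynomial [p - Q q] of degree [m.+1], with [q] the pencil
    polynomial of [p], is minimal for all the eigenvalues seen by [y]. *)
Lemma pencil_minimal_poly y (p : {poly F}) m : rank_one_cyclic y ->
    minimal_annihilator M y p m ->
  exists phi : {poly K}, [/\ phi \is monic, size phi = m.+2,
    kappa phi`_m = iota p`_m - Q &
    forall lambda, visible_eigenvalue y lambda ->
      root (map_poly kappa phi) lambda /\
      (forall g, root (map_poly kappa g) lambda -> (size g < size phi)%N -> g = 0)].
Proof.
move=> [y1 yD nondeg] py; have [mon_p sp p0 _] := py; pose q := pencil_poly M y a0 p.
have co_pq : coprimep p q by apply: pencil_coprime F_closed py nondeg.
have sq : (size q <= m.+1)%N by rewrite (leq_trans (size_pencil _ _ _ _)) // sp.
have q_m : q`_m = 1 by rewrite /q (pencil_subleading _ y1 mon_p sp).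
pose P := map_poly iota p - Q *: map_poly iota q.
have [phi phiE] : exists phi, map_poly kappa phi = P.
  apply: exists_map_poly => i; rewrite coefB coefZ !coef_map /=.
  have [[a aE] [b bE] [c cE]] := And3 (K_F p`_i) K_Q (K_F q`_i).
  by exists (a - b * c); rewrite rmorphB rmorphM /= aE bE cE.
have sQ : (size (Q *: map_poly iota q) < size (map_poly iota p))%N.
  by rewrite (leq_ltn_trans (size_scale_leq _ _)) // !size_map_poly sp.
have sphi : size phi = m.+2.
  rewrite -(size_map_poly kappa) phiE /P size_polyDl ?size_polyN //.
  by rewrite size_map_poly.
exists phi; split=> //.
- rewrite monicE -(fmorph_eq1 kappa) -lead_coef_map phiE /P.
  by rewrite lead_coefDl ?size_polyN // lead_coef_map (monicP mon_p) rmorph1.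
- by rewrite -coef_map phiE /P coefB coefZ !coef_map /= q_m rmorph1 mulr1.
move=> lambda [v Nv yv].
have lambdaE : (map_poly iota p).[lambda] = Q * (map_poly iota q).[lambda].
  have := krylov_eigenvector yD p Nv; rewrite p0 map_mx0 mul0mx => /esym/eqP.
  by rewrite scaler_eq0 (negPf yv) orbF subr_eq0 => /eqP.
split; first by rewrite phiE /P rootE !hornerE lambdaE subrr.
move=> g rg; rewrite sphi -sp; exact: (eigenvalue_degree_ge Q_tr co_pq lambdaE K_ratio rg).
Qed.

End OverFunctionField.

(** Both numbers are one less than the degree of [lambda] over [F(Q)]. *)
Lemma eigenvalue_degree_unique y y' p p' m m' lambda :
    rank_one_cyclic y -> minimal_annihilator M y p m ->
    rank_one_cyclic y' -> minimal_annihilator M y' p' m' ->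
    visible_eigenvalue y lambda -> visible_eigenvalue y' lambda ->
  m = m'.
Proof.
move=> wy py wy' py' ey ey'.
have [K [kappa [K_ratio K_Q K_F]]] := exists_function_field iota Q.
have [phi [mon_phi sphi _ phiP]] := pencil_minimal_poly K_ratio K_Q K_F wy py.
have [psi [mon_psi spsi _ psiP]] := pencil_minimal_poly K_ratio K_Q K_F wy' py'.
have [r_phi min_phi] := phiP lambda ey; have [r_psi min_psi] := psiP lambda ey'.
apply/eqP; rewrite eqn_leq; apply/andP; split; rewrite leqNgt; apply/negP => lt.
  by move: (monic_neq0 mon_psi); rewrite (min_phi psi r_psi) ?eqxx // sphi spsi.
by move: (monic_neq0 mon_phi); rewrite (min_psi phi r_phi) ?eqxx // sphi spsi.
Qed.

(** The normalized trace turns the relation between the eigenvalues into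
    [Q S = B] with [S] and [B] in [F], where [S] is the sum in the conclusion;
    as [Q] is transcendental over [F], [S = 0]. *)
Lemma eigenvalue_relation (I : finType) (y : I -> 'rV[F]_n) (p : I -> {poly F})
    (m : I -> nat) (lambda : I -> C) (l : I -> int) :
    (forall i, rank_one_cyclic (y i)) ->
    (forall i, minimal_annihilator M (y i) (p i) (m i)) ->
    (forall i, visible_eigenvalue (y i) (lambda i)) ->
    \sum_i lambda i *~ l i = 0 ->
  \sum_i ((m i).+1%:R^-1 : C) *~ l i = 0.
Proof.
move=> wy py ey rel.
have [K [kappa [K_ratio K_Q K_F]]] := exists_function_field iota Q.
have /fin_all_exists[phi phiP] : forall i, exists phi : {poly K},
    [/\ phi \is monic, size phi = (m i).+2, kappa phi`_(m i) = iota (p i)`_(m i) - Q,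
      root (map_poly kappa phi) (lambda i) &
      forall g, root (map_poly kappa g) (lambda i) -> (size g < size phi)%N -> g = 0].
  move=> i.
  have [phi [mon_phi sphi phim phiP]] := pencil_minimal_poly K_ratio K_Q K_F (wy i) (py i).
  by have [r_phi min_phi] := phiP _ (ey i); exists phi.
have charK : [pchar K] =i pred0.
  by move=> x; rewrite -(fmorph_pchar kappa) (fmorph_pchar iota).
have tr : \sum_i ((phi i)`_(m i) / (m i).+1%:R) *~ l i = 0.
  have H := @trace_relation K C kappa charK I lambda phi m l.
  by apply: H rel => i; have [] := phiP i.
pose S : F := \sum_i (m i).+1%:R^-1 *~ l i.
pose B : F := \sum_i ((p i)`_(m i) / (m i).+1%:R) *~ l i.
have SB : Q * iota S = iota B.
  apply/esym/eqP; rewrite -subr_eq0; apply/eqP; transitivity (kappa 0); last exact: rmorph0.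
  rewrite -tr !rmorph_sum mulr_sumr -sumrB; apply: eq_bigr => i _ /=.
  have [_ _ phim _ _] := phiP i.
  rewrite !rmorphMz /= !rmorphM /= !fmorphV phim !rmorph_nat.
  by rewrite mulrzAr -mulrzBl -mulrBl.
have S0 : S = 0.
  apply/eqP; apply: contraT => nz_S; case: Q_tr.
  have -> : Q = iota (B / S) by rewrite fmorph_div -SB mulfK // fmorph_eq0.
  exact: algebraic_id.
rewrite -[RHS](rmorph0 iota) -[in RHS]S0 rmorph_sum; apply: eq_bigr => i _.
by rewrite rmorphMz /= fmorphV rmorph_nat.
Qed.
End PencilEigenvalues.

(** * Characters of an orbit *)

Local Notation "z .@[ v ]" := (z 0 (enum_rank v)) (at level 2, format "z .@[ v ]").

Section Orbit.
Variables (V : finType) (e : rel V) (T : {perm V}) (x0 : V).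
Hypothesis T_aut : forall x y, e (T x) (T y) = e x y.
Let K := porbit T x0.
Let r := #|K|.
Variables (F : fieldType) (w : F).
Hypothesis w_prim : r.-primitive_root w.

Definition adjacency_mx : 'M[F]_#|V| := \matrix_(i, j) (e (enum_val i) (enum_val j))%:R.
Definition support_mx (S : {set V}) : 'M[F]_#|V| := diag_mx (\row_i (enum_val i \in S)%:R).

Lemma eq_at_vertices (z z' : 'rV[F]_#|V|) : (forall v, z.@[v] = z'.@[v]) -> z = z'.
Proof. by move=> zz; apply/rowP => i; rewrite -(enum_valK i). Qed.

Lemma adjacencyE (z : 'rV[F]_#|V|) v : (z *m adjacency_mx).@[v] = \sum_u z.@[u] * (e u v)%:R.
Proof.
rewrite mxE (reindex_onto enum_rank enum_val) => [|i _]; last exact: enum_valK.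
apply: eq_big => [u|u _]; first by rewrite enum_rankK eqxx.
by rewrite !mxE !enum_rankK.
Qed.

Lemma support_mxE (S : {set V}) (z : 'rV[F]_#|V|) v :
  (z *m support_mx S).@[v] = z.@[v] * (v \in S)%:R.
Proof. by rewrite mul_mx_diag !mxE enum_rankK. Qed.

Definition orbit_index v := index v (traject T x0 r).

(** The character [T^a |-> w ^ (k a)] of the cyclic group generated by [T],
    transported to the orbit of [x0] and extended by zero. *)
Definition orbit_character k : 'rV[F]_#|V| :=
  \row_i (if enum_val i \in K then w ^+ (k * orbit_index (enum_val i)) else 0).

Lemma iter_orbit_mod a : iter a T x0 = iter (a %% r) T x0.
Proof.
rewrite [in LHS](divn_eq a r) addnC iterD; congr iter.
by elim: (a %/ r)%N => //= q IHq; rewrite mulSn iterD IHq; apply: iter_porbit.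
Qed.

Lemma orbit_gt0 : (0 < r)%N.
Proof. by apply/card_gt0P; exists x0; apply: porbit_id. Qed.

Lemma orbit_iterP v : reflect (exists a, v = iter a T x0) (v \in K).
Proof.
rewrite /K porbit_traject; apply: (iffP trajectP) => [[a _ ->]|[a ->]]; first by exists a.
by exists (a %% r)%N; [rewrite ltn_mod orbit_gt0 | exact: iter_orbit_mod].
Qed.

Lemma orbit_characterE k a : (orbit_character k).@[iter a T x0] = w ^+ (k * a).
Proof.
have lt_a : (a %% r < r)%N by rewrite ltn_mod orbit_gt0.
have inK : iter a T x0 \in K by apply/orbit_iterP; exists a.
rewrite mxE enum_rankK inK -(prim_expr_mod w_prim) -[in RHS](prim_expr_mod w_prim).
congr (_ ^+ _); rewrite /orbit_index iter_orbit_mod.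
rewrite -(nth_traject T lt_a) index_uniq ?size_traject ?uniq_traject_porbit //.
by rewrite modnMmr.
Qed.

Lemma orbit_character_out k v : v \notin K -> (orbit_character k).@[v] = 0.
Proof. by move=> vK; rewrite mxE enum_rankK (negPf vK). Qed.

Lemma orbit_character_base k : (orbit_character k).@[x0] = 1.
Proof. by rewrite (orbit_characterE k 0) muln0. Qed.

Definition equivariant k (z : 'rV[F]_#|V|) := forall v, z.@[T v] = w ^+ k * z.@[v].

Lemma equivariant_iter k z v a : equivariant k z -> z.@[iter a T v] = w ^+ (k * a) * z.@[v].
Proof.
move=> eq_z; elim: a => [|a IHa] /=; first by rewrite muln0 mul1r.
by rewrite eq_z IHa mulnS exprD mulrA.
Qed.

Lemma orbit_character_equivariant k : equivariant k (orbit_character k).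
Proof.
move=> v; have [/orbit_iterP[a ->]|vK] := boolP (v \in K).
  by rewrite -iterS !orbit_characterE mulnS exprD.
rewrite !orbit_character_out ?mulr0 //.
apply: contra vK => /orbit_iterP[a TvE].
apply/orbit_iterP; exists (a + r.-1)%N; apply: (@perm_inj _ T).
by rewrite TvE -iterS -addnS prednK ?orbit_gt0 // iterD iter_porbit.
Qed.

Lemma equivariant_adjacency k z : equivariant k z -> equivariant k (z *m adjacency_mx).
Proof.
move=> eq_z v; rewrite !adjacencyE (reindex_inj (@perm_inj _ T)) mulr_sumr.
by apply: eq_bigr => u _; rewrite eq_z T_aut mulrA.
Qed.

Lemma equivariantP k c z z' :
  equivariant k z -> equivariant k z' -> equivariant k (z + c *: z').
Proof.
have E v : (z + c *: z').@[v] = z.@[v] + c * z'.@[v] by rewrite !mxE.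
by move=> eq_z eq_z' v; rewrite !E eq_z eq_z'; ring.
Qed.

Lemma equivariant_krylov k g : equivariant k (krylov adjacency_mx (orbit_character k) g).
Proof.
elim/poly_ind: g => [|g c IHg]; first by move=> v; rewrite raddf0 !mxE mulr0.
rewrite linearD /= krylovMX krylovC; apply: equivariantP.
  exact: equivariant_adjacency.
exact: orbit_character_equivariant.
Qed.

(** A [k]-equivariant vector is determined on the orbit by its value at [x0]. *)
Lemma equivariant_support k z : equivariant k z ->
  z *m support_mx K = z.@[x0] *: orbit_character k.
Proof.
move=> eq_z; apply: eq_at_vertices => v; rewrite support_mxE [RHS]mxE.
have [/orbit_iterP[a ->]|vK] := boolP (v \in K); last by rewrite orbit_character_out // !mulr0.
by rewrite mulr1 (equivariant_iter _ _ eq_z) orbit_characterE mulrC.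
Qed.

Lemma sum_root_orthogonal (k k' : 'I_r) :
  \sum_(a < r) (w ^+ k / w ^+ k') ^+ a = (if k == k' then r%:R else 0).
Proof.
have w0 : w != 0 by rewrite (prim_root_eq0 w_prim) -lt0n orbit_gt0.
have [->|ne] := eqVneq.
  rewrite (eq_bigr (fun=> 1)) ?sumr_const ?card_ord // => a _.
  by rewrite divff ?expf_neq0 // expr1n.
apply/eqP; have : (w ^+ k / w ^+ k') ^+ r - 1 = 0.
  rewrite expr_div_n -!exprM ![(_ * r)%N]mulnC !exprM (prim_expr_order w_prim).
  by rewrite !expr1n divr1 subrr.
rewrite subrX1 => /eqP; rewrite mulf_eq0 => /orP[|//].
rewrite subr_eq0 -(inj_eq (mulIf (expf_neq0 k' w0))) divfK ?expf_neq0 // mul1r.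
rewrite (eq_prim_root_expr w_prim) !modn_small // => /eqP kk.
by move: ne; rewrite -val_eqE /= kk eqxx.
Qed.

(** Evaluating the sum along the orbit of a vertex and pairing with the [k']-th
    power of [w] isolates [z k']. *)
Lemma equivariant_independent (z : 'I_r -> 'rV[F]_#|V|) :
  (forall k : 'I_r, equivariant k (z k)) -> \sum_k z k = 0 -> forall k, z k = 0.
Proof.
move=> eq_z z0 k'; apply: eq_at_vertices => v.
have w0 : w != 0 by rewrite (prim_root_eq0 w_prim) -lt0n orbit_gt0.
apply: (mulIf (prim_root_natf_neq0 w_prim)); rewrite mxE mul0r.
transitivity (\sum_(a < r) (w ^+ k') ^- a * (\sum_k z k).@[iter a T v]); last first.
  by rewrite z0 big1 // => a _; rewrite mxE mulr0.
transitivity (\sum_(k < r) (z k).@[v] * \sum_(a < r) (w ^+ k / w ^+ k') ^+ a).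
  rewrite (bigD1 k') //= sum_root_orthogonal eqxx big1 ?addr0 // => k ne.
  by rewrite sum_root_orthogonal (negPf ne) mulr0.
under eq_bigr do rewrite mulr_sumr.
rewrite exchange_big; apply: eq_bigr => a _ /=; rewrite summxE mulr_sumr.
apply: eq_bigr => k _; rewrite (equivariant_iter _ _ (eq_z k)) expr_div_n exprM.
by ring.
Qed.

(** The [r (d + 1)] vectors [y_k M^j] with [j <= d] are linearly dependent, and a
    dependence splits into its equivariant components. *)
Lemma exists_low_degree_annihilator d : (#|V| < r * d.+1)%N ->
  exists (k : 'I_r) (g : {poly F}), [/\ g != 0, (size g <= d.+1)%N &
     krylov adjacency_mx (orbit_character k) g = 0].
Proof.
move=> lt_V; pose u (kj : 'I_r * 'I_d.+1) := orbit_character kj.1 *m adjacency_mx ^+ kj.2.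
have [|c [[k j] nz_c] c0] := @exists_linear_dependence F _ _ u.
  by rewrite card_prod !card_ord.
pose g (k : 'I_r) : {poly F} := \poly_(j < d.+1) c (k, inord j).
exists k, (g k); split; last 1 first.
- apply: (@equivariant_independent (fun k => krylov adjacency_mx (orbit_character k) (g k))).
    by move=> i; apply: equivariant_krylov.
  rewrite -[RHS]c0 [RHS](eq_bigr (fun p => c (p.1, p.2) *: u (p.1, p.2))); last by case.
  rewrite -(pair_bigA _ (fun k j => c (k, j) *: u (k, j))) /=.
  apply: eq_bigr => i _; rewrite (@krylov_wide _ _ _ _ d.+1) ?size_poly //.
  by apply: eq_bigr => l _; rewrite coef_poly ltn_ord inord_val.
- apply: contraNneq nz_c => /(congr1 (fun q : {poly F} => q`_j)).
  by rewrite coef_poly ltn_ord inord_val coef0 => ->.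
- exact: size_poly.
Qed.
End Orbit.

Lemma sum_orbit (C : nmodType) (V : finType) (T : {perm V}) (x0 : V) (f : V -> C) :
  \sum_(b < #|porbit T x0|) f (enum_val b) = \sum_(a < #|porbit T x0|) f (iter a T x0).
Proof.
rewrite -(big_enum_val f) (eq_bigl (mem (traject T x0 #|porbit T x0|))) => [|v]; last first.
  by rewrite /= porbit_traject.
rewrite -big_uniq ?uniq_traject_porbit //=.
elim: #|_| => [|n IHn]; first by rewrite big_nil big_ord0.
by rewrite trajectSr -cats1 big_cat big_seq1 big_ord_recr IHn.
Qed.

(** * Walks and nondegeneracy *)

Section Walks.
Variables (V : finType) (e : rel V) (S : {set V}).

(** Natural numbers rather than field elements, so that counts can be compared with
    zero; a nonzero count stays nonzero in characteristic zero. *)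
Fixpoint walks j v : nat :=
  if j is i.+1 then (\sum_u walks i u * e u v)%N else (v \in S : nat).

Lemma walks_step j u v : (0 < walks j u)%N -> e u v -> (0 < walks j.+1 v)%N.
Proof. by move=> wu euv /=; rewrite (bigD1 u) //= euv muln1 addn_gt0 wu. Qed.

Lemma walks_path j u p : (0 < walks j u)%N -> path e u p -> (0 < walks (j + size p) (last u p))%N.
Proof.
elim: p j u => [|v p IHp] j u wu /=; first by rewrite addn0.
by case/andP=> euv pth; rewrite -addSnnS; apply: IHp pth; apply: walks_step wu euv.
Qed.

Lemma walks_gt0_path j v : (0 < walks j v)%N ->
  exists x p, [/\ x \in S, path e x p, last x p = v & size p = j].
Proof.
elim: j v => [|j IHj] v /=; first by rewrite lt0b => vS; exists v, [::].
rewrite lt0n sum_nat_eq0 negb_forall => /existsP[u].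
rewrite /= -lt0n muln_gt0 lt0b => /andP[/IHj[x [p [xS pth lst sz]]] euv].
by exists x, (rcons p v); rewrite rcons_path last_rcons size_rcons pth lst sz.
Qed.

Lemma path_graph_dist x p : path e x p ->
  exists2 m, graph_dist e x (last x p) m & (m <= size p)%N.
Proof.
have [n] := ubnP (size p); elim: n p => // n IHn p lt_n pth.
have [[q [pthq lst lt]]|nex] := pselect (exists q,
    [/\ path e x q, last x q = last x p & (size q < size p)%N]).
  have [||m dm le] := IHn q; [by apply: leq_trans lt _|by []|].
  by exists m; [rewrite -lst | apply: leq_trans le (ltnW lt)].
exists (size p) => //; split; first by exists p.
move=> q pthq lst; rewrite leqNgt; apply/negP => lt; apply: nex.
by exists q.
Qed.

Lemma walks_below_dist v d j : set_dist e S v d -> (j < d)%N -> walks j v = 0%N.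
Proof.
move=> [_ min] lt; apply/eqP; rewrite -leqn0 leqNgt; apply/negP => /walks_gt0_path.
case=> x [p [xS /path_graph_dist[m dm le] lst sz]].
by have := min x m xS; rewrite -lst => /(_ dm); lia.
Qed.

(** The [j]-th vertex of a geodesic from [S] to [v]: a shorter walk to it could be
    continued along the geodesic and would reach [v] too early. *)
Lemma exists_first_walk v d j : set_dist e S v d -> (j <= d)%N ->
  exists2 u, (0 < walks j u)%N & forall i, (i < j)%N -> walks i u = 0%N.
Proof.
move=> dv le_j; have [[x xS [[p [pth lst sz]] _]] _] := dv.
have pthT : path e x (take j p) by rewrite -(cat_take_drop j p) cat_path in pth; case/andP: pth.
have pthD : path e (last x (take j p)) (drop j p).
  by rewrite -(cat_take_drop j p) cat_path in pth; case/andP: pth.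
exists (last x (take j p)).
  have := @walks_path 0 x (take j p); rewrite add0n size_take sz /= xS.
  rewrite (_ : (if _ then _ else _) = j); first exact.
  by case: ltnP => //; lia.
move=> i lt_i; apply/eqP; rewrite -leqn0 leqNgt; apply/negP => wi.
have := walks_path wi pthD; rewrite size_drop sz -last_cat cat_take_drop lst.
by rewrite (walks_below_dist dv) //; lia.
Qed.

Variable F : fieldType.

Lemma walksE (y : 'rV[F]_#|V|) j v : (forall u, y.@[u] = (u \in S)%:R) ->
  (y *m adjacency_mx e F ^+ j).@[v] = (walks j v)%:R.
Proof.
move=> yE; elim: j v => [|j IHj] v; first by rewrite expr0 mulmx1 yE.
rewrite exprSr -mulmxE mulmxA adjacencyE natr_sum; apply: eq_bigr => u _.
by rewrite IHj natrM.
Qed.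

(** If [g] has degree [j <= d], take a vertex at distance [j] from [S].  The vector
    [1_S g(M)] takes there the value of the leading coefficient of [g] times the
    number of geodesics, which is not zero. *)
Lemma indicator_annihilator_size (y : 'rV[F]_#|V|) d (g : {poly F}) :
    [pchar F] =i pred0 -> (forall u, y.@[u] = (u \in S)%:R) ->
    largest_dist e S d -> g != 0 -> krylov (adjacency_mx e F) y g = 0 ->
  (d.+1 < size g)%N.
Proof.
move=> charF yE [_ [v dv]] nz_g g0; rewrite ltnNge; apply/negP => le_g.
have g_gt0 : (0 < size g)%N by rewrite size_poly_gt0.
have [|u wu first] := @exists_first_walk v d (size g).-1 dv; first by lia.
have : krylov (adjacency_mx e F) y g 0 (enum_rank u) = 0 by rewrite g0 mxE.
rewrite /krylov summxE; case sg: (size g) g_gt0 wu first => [|m] // _ wu first.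
rewrite big_ord_recr /= big1 => [|i _].
  rewrite add0r mxE walksE // => /eqP; rewrite mulf_eq0.
  have -> : g`_m = lead_coef g by rewrite lead_coefE sg.
  rewrite lead_coef_eq0 (negPf nz_g) /=.
  by move/pcharf0P: charF => ->; rewrite -leqn0 leqNgt wu.
by rewrite mxE walksE // first ?mulr0.
Qed.
End Walks.

Section Nondegenerate.
Variables (V : finType) (e : rel V) (T : {perm V}) (x0 : V).
Hypothesis e_sym : symmetric e.
Hypothesis T_aut : forall x y, e (T x) (T y) = e x y.
Variables (F : fieldType) (w : F) (C : numClosedFieldType) (iota : {rmorphism F -> C}).
Hypothesis w_prim : (#|porbit T x0|).-primitive_root w.

(** By equivariance [z = y h(M)] vanishes on the whole orbit, hence is orthogonal to
    [y].  As [M] is real symmetric and [z] is an eigenvector, [z] is then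
    orthogonal to every [y g(M)], in particular to itself. *)
Lemma orbit_character_nondegenerate k (h : {poly F}) (a : F) :
    let y := orbit_character T x0 w k in
    krylov (adjacency_mx e F) y h *m adjacency_mx e F = a *: krylov (adjacency_mx e F) y h ->
    (krylov (adjacency_mx e F) y h).@[x0] = 0 ->
  krylov (adjacency_mx e F) y h = 0.
Proof.
move=> y; set A := adjacency_mx e F; set z := krylov A y h => zA z0.
have eq_z := equivariant_krylov T_aut w_prim k h : equivariant T w k z.
pose ip (u u' : 'rV[F]_#|V|) := \sum_v iota u.@[v] * (iota u'.@[v])^*.
have ipA u u' : ip (u *m A) u' = ip u (u' *m A).
  rewrite /ip; transitivity (\sum_v \sum_t iota u.@[t] * (e t v)%:R * (iota u'.@[v])^*).
    apply: eq_bigr => v _; rewrite adjacencyE rmorph_sum mulr_suml.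
    by apply: eq_bigr => t _; rewrite rmorphM rmorph_nat.
  rewrite exchange_big; apply: eq_bigr => t _ /=.
  rewrite adjacencyE !rmorph_sum mulr_sumr; apply: eq_bigr => v _ /=.
  by rewrite !rmorphM /= !rmorph_nat e_sym; ring.
have ip_y : ip z y = 0.
  apply: big1 => v _; have [/(orbit_iterP T x0)[b ->]|vK] := boolP (v \in porbit T x0).
    by rewrite (equivariant_iter _ _ eq_z) z0 mulr0 rmorph0 mul0r.
  by rewrite orbit_character_out // !rmorph0 mulr0.
have ipP u c u' : ip z (u + c *: u') = ip z u + (iota c)^* * ip z u'.
  rewrite /ip mulr_sumr -big_split; apply: eq_bigr => v _ /=.
  have -> : (u + c *: u').@[v] = u.@[v] + c * u'.@[v] by rewrite !mxE.
  by rewrite !rmorphD !rmorphM /=; ring.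
have ipZ c u u' : ip (c *: u) u' = iota c * ip u u'.
  rewrite /ip mulr_sumr; apply: eq_bigr => v _.
  by rewrite mxE rmorphM mulrA.
have ip0 g : ip z (krylov A y g) = 0.
  elim/poly_ind: g => [|g c IHg].
    by rewrite raddf0 /ip big1 // => v _; rewrite [X in _ * (iota X)^*]mxE !rmorph0 mulr0.
  by rewrite linearD /= krylovMX krylovC ipP ip_y mulr0 addr0 -ipA zA ipZ IHg mulr0.
apply: eq_at_vertices => v; rewrite mxE; apply/eqP; rewrite -(fmorph_eq0 iota).
have /eqP := ip0 h; rewrite psumr_eq0 => [/allP/(_ v (mem_index_enum v))|u _].
  by rewrite /= mul_conjC_eq0.
exact: mul_conjC_ge0.
Qed.
End Nondegenerate.

Lemma orbit_character_rank_one (V : finType) (e : rel V) (T : {perm V}) (x0 : V)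
   (F : fieldType) (w : F) (C : numClosedFieldType) (iota : {rmorphism F -> C}) k :
   symmetric e -> automorphism e T -> (#|porbit T x0|).-primitive_root w ->
  rank_one_cyclic (adjacency_mx e F) (support_mx F (porbit T x0)) (enum_rank x0)
    (orbit_character T x0 w k).
Proof.
move=> e_sym T_aut w_prim; split.
- exact: orbit_character_base.
- by move=> g; apply: equivariant_support => //; apply: equivariant_krylov.
- by move=> h a; apply: (orbit_character_nondegenerate e_sym T_aut iota w_prim).
Qed.

(** * Kronecker approximation *)

Section ComplexExponential.
Local Open Scope complex_scope.

(** The complex exponential [exp(i x)]. *)
Definition cis (R : realType) (x : R) : R[i] := cos x +i* sin x.

Lemma cisD (R : realType) (x y : R) : cis (x + y) = cis x * cis y.
Proof.
rewrite /cis cosD sinD; apply/eqP; rewrite eq_complex /= eqxx /=.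
by apply/eqP; rewrite addrC [sin x * _]mulrC mulrC; congr (_ + _); apply: mulrC.
Qed.

Lemma cis0 (R : realType) : cis 0 = 1 :> R[i].
Proof. by rewrite /cis cos0 sin0. Qed.

Lemma cis_sum (R : realType) (I : finType) (u : I -> R) :
  cis (\sum_i u i) = \prod_i cis (u i).
Proof. exact: (big_morph _ (@cisD R) (cis0 R)). Qed.

Definition normsq (R : realType) (z : R[i]) : R :=
  complex.Re z ^+ 2 + complex.Im z ^+ 2.

Lemma normsqM (R : realType) (z w : R[i]) : normsq (z * w) = normsq z * normsq w.
Proof. by case: z w => [a b] [c d]; rewrite /normsq /=; ring. Qed.

Lemma normsqX (R : realType) (z : R[i]) p : normsq (z ^+ p) = normsq z ^+ p.
Proof.
elim: p => [|p IHp]; first by rewrite !expr0 /normsq /= expr1n expr0n addr0.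
by rewrite !exprS normsqM IHp.
Qed.

Lemma normsq_ge0 (R : realType) (z : R[i]) : 0 <= normsq z.
Proof. by rewrite addr_ge0 ?sqr_ge0. Qed.

Lemma normsq_sum_cis (R : realType) (I : finType) (u : I -> R) :
  normsq (\sum_i cis (u i)) = \sum_i \sum_j cos (u i - u j).
Proof.
have E : \sum_i cis (u i) = (\sum_i cos (u i)) +i* (\sum_i sin (u i)).
  have : forall r : seq I, \sum_(i <- r) cis (u i) =
     (\sum_(i <- r) cos (u i)) +i* (\sum_(i <- r) sin (u i)).
    by elim=> [|i r IHr]; rewrite ?big_nil // !big_cons IHr.
  exact.
rewrite E /normsq /= !expr2 !mulr_suml -big_split; apply: eq_bigr => i _ /=.
by rewrite !mulr_sumr -big_split; apply: eq_bigr => j _; rewrite cosB.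
Qed.

(** The sum telescopes after multiplication by [2 sin (x / 2)]. *)
Lemma sum_cos_arith (R : realType) (x y : R) N :
  (2 * sin (x / 2)) * (\sum_(n < N) cos (n%:R * x + y)) =
    sin (N%:R * x + y - x / 2) - sin (y - x / 2).
Proof.
elim: N => [|N IHN]; first by rewrite big_ord0 mulr0 mul0r add0r subrr.
rewrite big_ord_recr /= mulrDr IHN.
have -> : N.+1%:R * x + y - x / 2 = (N%:R * x + y) + x / 2.
  by rewrite -natr1; field.
by move: (N%:R * x + y) (x / 2) => A h; rewrite !sinB sinD; ring.
Qed.

Lemma sum_cos_bound (R : realType) (x y : R) N : sin (x / 2) != 0 ->
  - `|sin (x / 2)|^-1 <= \sum_(n < N) cos (n%:R * x + y).
Proof.
move=> s0; set S := \sum_(n < N) _.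
have Sb : `|S| <= `|sin (x / 2)|^-1.
  have : `|2 * sin (x / 2) * S| <= 2.
    rewrite sum_cos_arith (le_trans (ler_normB _ _)) //.
    by rewrite [leRHS](_ : _ = 1 + 1) ?lerD ?sin_max.
  rewrite !normrM (@ger0_norm _ 2) // -mulrA -[leRHS]mulr1 ler_pM2l // => h.
  by rewrite -[leRHS]mul1r ler_pdivlMr ?normr_gt0 // mulrC.
by have := ler_norm (- S); rewrite normrN; lra.
Qed.

(** With [A = c (1 + d)] and [p = 2 k s], Bernoulli gives
    [(1 + d)^p >= (1 + s d)^(2 k)], which exceeds [(p + 1)^k] once
    [s d^2 > 2 k]. *)
Lemma exp_beats_poly (R : realType) (A c : R) k : 0 <= c -> c < A ->
  exists p : nat, c ^+ p * p.+1%:R ^+ k < A ^+ p.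
Proof.
rewrite le_eqVlt => /predU1P[<- A0|c0 cA]; first by exists 1%N; rewrite !expr1 mul0r.
case: k => [|k]; first by exists 1%N; rewrite !expr1 expr0 mulr1.
have [d d0 AE] : exists2 d, 0 < d & A = c * (1 + d).
  exists (A / c - 1); first by rewrite subr_gt0 ltr_pdivlMr // mul1r.
  by rewrite addrC subrK mulrC divfK // gt_eqF.
have bern s : 1 + s%:R * d <= (1 + d) ^+ s.
  elim: s => [|s IHs]; first by rewrite mul0r addr0 expr0.
  rewrite exprSr -natr1; have := IHs; rewrite -(ler_pM2r (x := 1 + d)) ?addr_gt0 // => h.
  apply: le_trans h; have : 0 <= s%:R * d * d by rewrite !mulr_ge0 // ltW.
  by nra.
have [s sb] : exists s : nat, 2 * k.+1%:R < s%:R * d ^+ 2.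
  exists (Num.bound (2 * k.+1%:R / d ^+ 2)).
  rewrite -ltr_pdivrMr ?exprn_gt0 //; apply: le_lt_trans (archi_boundP _); first exact: lexx.
  by rewrite divr_ge0 ?mulr_ge0 ?exprn_ge0 ?(ltW d0).
exists (s * 2 * k.+1)%N.
rewrite AE exprMn ltr_pM2l ?exprn_gt0 // !exprM ltr_pXn2r ?nnegrE ?exprn_ge0 ?addr_ge0 ?(ltW d0) //.
have : (1 + s%:R * d) ^+ 2 <= ((1 + d) ^+ s) ^+ 2.
  by rewrite ler_pXn2r ?nnegrE ?exprn_ge0 ?addr_ge0 ?mulr_ge0 ?(ltW d0) // bern.
apply: lt_le_trans; rewrite -natr1 !natrM.
have s0 : 0 < s%:R :> R.
  by case: s sb => [|//]; rewrite mul0r ltNge mulr_ge0.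
have : 2 * k.+1%:R * s%:R < s%:R * d ^+ 2 * s%:R by rewrite ltr_pM2r.
have : 0 < s%:R * d by rewrite mulr_gt0.
by nra.
Qed.

Lemma cisX (R : realType) (x : R) n : cis x ^+ n = cis (x *+ n).
Proof. by elim: n => [|n IHn]; rewrite ?expr0 ?mulr0n ?cis0 // exprS IHn mulrS cisD. Qed.

Lemma cis_conj (R : realType) (x : R) : Num.conj (cis x) = cis (- x).
Proof. by rewrite /cis cosN sinN. Qed.

Lemma cis_unit (R : realType) (x : R) : cis x * Num.conj (cis x) = 1.
Proof. by rewrite cis_conj -cisD subrr cis0. Qed.

Lemma cis_primitive_root (R : realType) r : (0 < r)%N ->
  r.-primitive_root (cis (pi *+ 2 / r%:R) : R[i]).
Proof.
move=> r0; have rr : (r%:R : R) != 0 by rewrite pnatr_eq0 -lt0n.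
apply/andP; split=> //; apply/forallP => i; rewrite unity_rootE cisX.
have -> : (pi *+ 2 / r%:R) *+ i.+1 = (pi * (i.+1%:R / r%:R)) *+ 2 :> R.
  by rewrite -[LHS]mulr_natr -[RHS]mulrnAl mulrAC mulrA.
have [->|ne] := eqVneq i.+1 r.
  by rewrite divff // mulr1 /cis cos2pi sin2pi eqxx.
rewrite eqbF_neg eq_complex /= negb_and; apply/orP; left.
have lt_i : (i.+1 < r)%N by rewrite ltn_neqAle ne ltn_ord.
set x := pi * _; have x0 : 0 < sin x.
  apply: sin_gt0_pi; rewrite mulr_gt0 ?pi_gt0 ?divr_gt0 ?ltr0n //=.
  by rewrite gtr_pMr ?pi_gt0 // ltr_pdivrMr ?ltr0n // mul1r ltr_nat.
rewrite cos_mulr2n; apply/eqP => c1.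
have := cos2Dsin2 x; have : 0 < sin x ^+ 2 by rewrite exprn_gt0.
by move: c1; rewrite mulr2n => c1; lra.
Qed.

End ComplexExponential.

Section Approximation.
Local Open Scope complex_scope.

Section Words.
Variables (I : finType) (p : nat).
Implicit Types s t : {ffun 'I_p -> I}.

(** Sums along a word depend only on its content, and there are few contents
    compared with the number of words. *)
Definition content s : {ffun I -> 'I_p.+1} := [ffun i => inord #|[set a | s a == i]|].

Lemma contentE s i : content s i = #|[set a | s a == i]| :> nat.
Proof.
rewrite ffunE inordK // ltnS -[leqRHS](card_ord p); exact: max_card.
Qed.

Lemma sum_word (V : zmodType) (g : I -> V) s :
  \sum_a g (s a) = \sum_i g i *+ content s i.
Proof.
rewrite (partition_big s predT) //=; apply: eq_bigr => i _.
rewrite contentE -sumr_const; apply: eq_big => [a|a /eqP -> //]; by rewrite inE.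
Qed.

(** There are [#|I|^p] words and at most [(p + 1)^#|I|] contents, so some content
    is shared by at least [#|I|^p / (p + 1)^#|I|] words; the pairs of such words
    suffice. *)
Lemma card_same_content :
  (#|I| ^ (2 * p) <= #|[set st : {ffun 'I_p -> I} * {ffun 'I_p -> I} |
                          content st.1 == content st.2]| * (p.+1 ^ (2 * #|I|)))%N.
Proof.
pose fib k := [set s | content s == k].
have [k kP] : exists k, (#|I| ^ p <= #|fib k| * p.+1 ^ #|I|)%N.
  apply/existsP; apply: contraT; rewrite negb_exists => /forallP lt.
  have : (\sum_k #|fib k| * p.+1 ^ #|I| < \sum_(k : {ffun I -> 'I_p.+1}) #|I| ^ p)%N.
    have k0 : {ffun I -> 'I_p.+1} := [ffun=> ord0].
    rewrite (bigD1 k0) //= [X in (_ < X)%N](bigD1 k0) //= -addSn.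
    apply: leq_add; first by rewrite ltnNge lt.
    by apply: leq_sum => k _; rewrite ltnW // ltnNge lt.
  rewrite -big_distrl /= sum_nat_const card_ffun !card_ord.
  have -> : (\sum_k #|fib k| = #|I| ^ p)%N.
    rewrite -[in RHS](card_ord p) -card_ffun -sum1_card (partition_big content predT) //=.
    by apply: eq_bigr => k _; rewrite sum1dep_card.
  by rewrite mulnC ltnn.
rewrite ![(2 * _)%N]mulnC !expnM.
apply: leq_trans (_ : (#|fib k| * p.+1 ^ #|I|) ^ 2 <= _)%N; first by rewrite leq_sqr.
rewrite expnMn leq_mul2r; apply/orP; right.
rewrite -mulnn -cardsX; apply: subset_leq_card; apply/fintype.subsetP => -[s t].
by rewrite !inE /= => /andP[/eqP -> /eqP ->].
Qed.
End Words.

Section Kronecker.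
Variables (R : realType) (I : finType) (theta alpha : I -> R) (i0 : I).
Hypothesis theta0 : theta i0 = 0.
Hypothesis alpha0 : alpha i0 = 0.
Hypothesis relation : forall l : I -> int,
  \sum_i theta i *~ l i = 0 -> \sum_i alpha i *~ l i = 0.

(** The modulus of [f t] is close to [#|I|] exactly when all the terms are close
    to the term [1] at [i0]. *)
Let f t := \sum_i cis (theta i * t - alpha i).

Lemma normsq_power_expand t p : normsq (f t) ^+ p =
  \sum_(s : {ffun 'I_p -> I}) \sum_(s' : {ffun 'I_p -> I})
    cos ((\sum_a theta (s a) - \sum_a theta (s' a)) * t
         - (\sum_a alpha (s a) - \sum_a alpha (s' a))).
Proof.
rewrite -normsqX -[in LHS](card_ord p) -prodr_const bigA_distr_bigA /=.
rewrite (eq_bigr (fun s : {ffun 'I_p -> I} => cis (\sum_a (theta (s a) * t - alpha (s a))))).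
  rewrite normsq_sum_cis; apply: eq_bigr => s _; apply: eq_bigr => s' _.
  by rewrite !sumrB -!mulr_suml; congr cos; ring.
by move=> s _; rewrite cis_sum.
Qed.

Lemma word_relation p (s s' : {ffun 'I_p -> I}) :
  \sum_a theta (s a) = \sum_a theta (s' a) -> \sum_a alpha (s a) = \sum_a alpha (s' a).
Proof.
move/eqP; rewrite -subr_eq0 => /eqP; rewrite !sum_word -sumrB => rel.
apply/eqP; rewrite -subr_eq0 -sumrB; apply/eqP.
rewrite (eq_bigr (fun i => alpha i *~ ((content s i)%:Z - (content s' i)%:Z))).
  apply: relation; rewrite -[RHS]rel; apply: eq_bigr => i _.
  by rewrite mulrzBr !pmulrn.
by move=> i _; rewrite mulrzBr !pmulrn.
Qed.

(** Expanding [|f t|^(2 p)] over pairs of words of length [p] and averaging over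
    the times [n h], only the pairs of equal frequency survive, each of them
    contributing [1] because the phases agree as well; there are many such pairs
    by [card_same_content]. *)
Lemma mean_power_bound (c : R) p : (forall t, 0 <= t -> normsq (f t) <= c) ->
  #|I|%:R ^+ (2 * p) <= c ^+ p * p.+1%:R ^+ (2 * #|I|).
Proof.
move=> fc; pose W := {ffun 'I_p -> I}.
pose dth (s : W * W) := \sum_a theta (s.1 a) - \sum_a theta (s.2 a).
pose dal (s : W * W) := \sum_a alpha (s.1 a) - \sum_a alpha (s.2 a).
pose T := \sum_s `|dth s|.
have T0 : 0 <= T by apply: sumr_ge0.
(* the step is so small that no nonzero frequency is aliased to zero *)
pose h := (1 + T)^-1.
have h0 : 0 < h by rewrite invr_gt0; lra.
have sin0 s : dth s != 0 -> sin (dth s * h / 2) != 0.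
  move=> nz; have le_T : `|dth s| <= T by rewrite /T (bigD1 s) //= lerDl sumr_ge0.
  have : 0 < sin (`|dth s| * h / 2).
    apply: sin2_gt0; have d0 : 0 < `|dth s| by rewrite normr_gt0.
    have : `|dth s| * h < 1 by rewrite /h ltr_pdivrMr; lra.
    have := mulr_gt0 d0 h0; lra.
  case: (ltrP 0 (dth s)) => [/gtr0_norm ->|/ler0_norm ->]; first by move/gt_eqF ->.
  by rewrite !mulNr sinN oppr_gt0 => /lt_eqF ->.
pose E := [set s : W * W | dth s == 0].
pose B := \sum_(s in ~: E) `|sin (dth s * h / 2)|^-1.
have key N : N%:R * (#|E|%:R - c ^+ p) <= B.
  have le1 : \sum_(n < N) normsq (f (n%:R * h)) ^+ p <= N%:R * c ^+ p.
    rewrite mulr_natl -[X in _ *+ X](card_ord N) -sumr_const; apply: ler_sum => n _.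
    by rewrite lerXn2r ?nnegrE ?normsq_ge0 ?fc ?(le_trans (normsq_ge0 _) (fc 0 _)) // mulr_ge0 // ltW.
  have E1 : \sum_(n < N) normsq (f (n%:R * h)) ^+ p =
      \sum_(s : W * W) \sum_(n < N) cos (n%:R * (dth s * h) - dal s).
    rewrite [RHS]exchange_big; apply: eq_bigr => n _.
    rewrite normsq_power_expand pair_big; apply: eq_bigr => s _ /=.
    by rewrite /dth /dal; congr cos; ring.
  have le2 : N%:R * #|E|%:R - B <= \sum_(n < N) normsq (f (n%:R * h)) ^+ p.
    rewrite E1 (bigID (mem E)) /=; apply: lerD.
      rewrite -natrM mulnC natrM mulr_natl -sumr_const; apply: ler_sum => s.
      rewrite inE => /eqP d0; rewrite d0.
      have -> : dal s = 0.
        by apply/eqP; rewrite subr_eq0; apply/eqP/word_relation/eqP; rewrite -subr_eq0 -/(dth s) d0.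
      under eq_bigr do rewrite mul0r mulr0 subr0 cos0.
      by rewrite sumr_const card_ord.
    rewrite /B -sumrN [leRHS](eq_bigl (mem (~: E))); last by move=> s; rewrite !inE.
    apply: ler_sum => s; rewrite !inE => nz.
    exact: (sum_cos_bound (- dal s) N (sin0 _ nz)).
  by rewrite mulrBr lerBlDr; move: le1 le2; lra.
have le_E : #|E|%:R <= c ^+ p.
  rewrite leNgt; apply/negP => lt.
  have d0 : 0 < #|E|%:R - c ^+ p by rewrite subr_gt0.
  have B0 : 0 <= B by apply: sumr_ge0 => s _; rewrite invr_ge0.
  have := archi_boundP (divr_ge0 B0 (ltW d0)); rewrite ltr_pdivrMr // => h1.
  by have := key (Num.bound (B / (#|E|%:R - c ^+ p))); rewrite leNgt h1.
apply: le_trans (_ : #|E|%:R * p.+1%:R ^+ (2 * #|I|) <= _); last first.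
  by rewrite ler_wpM2r // exprn_ge0.
rewrite -!natrX -natrM ler_nat (leq_trans (card_same_content I p)) // leq_mul2r.
apply/orP; right; apply: subset_leq_card; apply/fintype.subsetP => s; rewrite !inE => /eqP eqc.
by rewrite /dth !sum_word eqc subrr.
Qed.

(** If the conclusion failed, [|f t|^2] would be at most [#|I|^2 - e] for all
    [t >= 0]; the lower bound on its power means then contradicts the comparison
    of exponentials with polynomials. *)
Lemma kronecker_pointed e : 0 < e ->
  exists2 t, 0 <= t & forall i, 1 - cos (theta i * t - alpha i) < e.
Proof.
move=> e0; have [[t t0 tP]|nex] := pselect (exists2 t, 0 <= t &
  forall i, 1 - cos (theta i * t - alpha i) < e); first by exists t.
pose c := #|I|%:R ^+ 2 - e : R.
have fc t : 0 <= t -> normsq (f t) <= c.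
  move=> t0; have [i ei] : exists i, e <= 1 - cos (theta i * t - alpha i).
    apply/not_existsP => ne; case: nex; exists t => // i; rewrite ltNge; apply/negP; exact: ne.
  pose u i := theta i * t - alpha i.
  have u0 : u i0 = 0 by rewrite /u theta0 alpha0 mul0r subr0.
  have -> : normsq (f t) = #|I|%:R ^+ 2 - \sum_i \sum_j (1 - cos (u i - u j)).
    rewrite normsq_sum_cis [in RHS](eq_bigr (fun i => #|I|%:R - \sum_j cos (u i - u j))).
      by rewrite [in RHS]sumrB sumr_const -mulrnA -natrX -mulnn subKr.
    by move=> j _; rewrite sumrB sumr_const.
  have pos j k : 0 <= 1 - cos (u j - u k) by rewrite subr_ge0 cos_le1.
  rewrite /c lerD2l lerN2 (bigD1 i) //= (bigD1 i0) //= u0 subr0 -addrA.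
  by rewrite (le_trans ei) // lerDl addr_ge0 ?sumr_ge0 // => j _; rewrite sumr_ge0.
have c0 : 0 <= c by apply: le_trans (fc 0 _); rewrite ?normsq_ge0.
have [|p lt_p] := @exp_beats_poly _ (#|I|%:R ^+ 2) c (2 * #|I|) c0.
  by rewrite /c; lra.
by have := mean_power_bound p fc; rewrite exprM leNgt lt_p.
Qed.
End Kronecker.

(** Kronecker's theorem, for frequencies that need not be independent.  The
    reference point needed for the pointed version is obtained by adjoining a
    frequency and a phase equal to [0]. *)
Lemma kronecker (R : realType) (I : finType) (theta alpha : I -> R) (e : R) :
    (forall l : I -> int, \sum_i theta i *~ l i = 0 -> \sum_i alpha i *~ l i = 0) ->
    0 < e ->
  exists2 t, 0 <= t & forall i, 1 - cos (theta i * t - alpha i) < e.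
Proof.
move=> rel e0.
pose ext (g : I -> R) (o : option I) := if o is Some i then g i else 0.
have big_ext (g : I -> R) (l : option I -> int) :
    \sum_o ext g o *~ l o = \sum_i g i *~ l (Some i).
  rewrite (bigD1 None) //= mul0rz add0r (reindex_omap Some id) //=; last by case.
  by apply: eq_big => [i|i _] //; rewrite eqxx.
have [||l|t t0 tP] := @kronecker_pointed R (option I) (ext theta) (ext alpha) None _ _ _ e e0 => //.
  by rewrite !big_ext; apply: rel.
by exists t => // i; apply: (tP (Some i)).
Qed.

End Approximation.

(** * Algebraic numbers *)

Section AlgebraicNumbers.
Local Open Scope complex_scope.

(** The field of all complex algebraic numbers.  It is algebraically closed in
    [R[i]], because being algebraic is transitive. *)
Lemma exists_algebraic_numbers (R : realType) : exists (F : fieldType) (iota : {rmorphism F -> R[i]}),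
  [/\ forall x, algebraicOver iota x -> exists a, iota a = x,
      forall x, algebraicOver (ratr : rat -> R[i]) x -> exists a, iota a = x &
      forall q : R, transcendental q -> ~ algebraicOver iota q%:C].
Proof.
pose P (x : R[i]) := algebraicOver (ratr : rat -> R[i]) x.
have [|||F [iota [Pi iP]]] := @exists_subfield _ P.
- exact: algebraic1.
- by move=> x y; apply: algebraic_sub.
- by move=> x y; apply: algebraic_div.
have trans x : algebraicOver iota x -> P x.
  case=> p nz_p rp; apply/integral_algebraic/(integral_root _ rp).
    by rewrite map_poly_eq0.
  move=> y /(nthP 0)[i lt_i <-]; rewrite coef_map; apply/integral_algebraic; exact: Pi.
exists F, iota; split=> [x /trans/iP|x|q trq /trans [p nz_p rp]] //; first exact: iP.
apply: trq; exists p => //.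
rewrite -(fmorph_root (real_complex R)) -map_poly_comp.
by rewrite (eq_map_poly (g := ratr)) // => x /=; rewrite fmorph_rat.
Qed.

Lemma exists_algebraic_root_of_unity (R : realType) (F : fieldType) (iota : {rmorphism F -> R[i]}) r :
    (0 < r)%N -> (forall x, algebraicOver (ratr : rat -> R[i]) x -> exists a, iota a = x) ->
  exists w : F, r.-primitive_root w.
Proof.
move=> r0 alg; have pr := @cis_primitive_root R r r0.
have [w wE] : exists w, iota w = cis (pi *+ 2 / r%:R).
  apply: alg; exists ('X^r - 1).
    by rewrite -size_poly_eq0 size_XnsubC.
  rewrite rmorphB rmorph1 /= map_polyXn rootE !hornerE.
  by rewrite (prim_expr_order pr) subrr.
by exists w; rewrite -(fmorph_primitive_root iota) wE.
Qed.

End AlgebraicNumbers.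

(** * The evolution of a diagonalizable matrix *)

Section Evolution.
Local Open Scope classical_set_scope.
Local Open Scope complex_scope.

Lemma cvg_mx_entries (T : topologicalType) m n (u : nat -> 'M[T]_(m, n)) (L : 'M[T]_(m, n)) :
  (forall i j, (fun k => u k i j) @ \oo --> L i j) -> u @ \oo --> L.
Proof.
move=> uL A [P LP PA].
have : \forall k \near \oo, forall i j, P i j (u k i j).
  apply: filter_forall => i; apply: filter_forall => j.
  exact: (uL i j _ (LP i j)).
by apply: filterS => k Pk; apply: PA.
Qed.

Lemma cvg_real_complex (R : realType) (u : nat -> R) (l : R) :
  u @ \oo --> l -> (fun n => (u n)%:C : R[i]) @ \oo --> (l%:C : R[i]).
Proof.
move=> ul; apply/cvgrPdist_lt => e e0.
have eE : e = (complex.Re e)%:C by rewrite RRe_real // gtr0_real.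
have re0 : 0 < complex.Re e by rewrite -ltcR -eE.
move/cvgrPdist_lt: ul => /(_ _ re0); apply: filterS => n.
by rewrite -rmorphB /= normc_def /= expr0n addr0 sqrtr_sqr [in X in _ -> X]eE ltcR.
Qed.

Lemma cvg_sum_complex (R : realType) (I : Type) (r : seq I) (f : I -> nat -> R[i]) (l : I -> R[i]) :
  (forall i, f i @ \oo --> l i) ->
  (fun n => \sum_(i <- r) f i n) @ \oo --> \sum_(i <- r) l i.
Proof.
move=> fl; elim: r => [|i r IHr].
  by under eq_fun do rewrite big_nil; rewrite big_nil; exact: cvg_cst.
by under eq_fun do rewrite big_cons; rewrite big_cons; exact: (cvgD (fl i) IHr).
Qed.

(** Separating even and odd terms gives the defining series of cosine and sine. *)
Lemma exp_series_cis (R : realType) (x : R) :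
  (fun n => \sum_(0 <= k < n) (k`!%:R : R[i])^-1 * ('i * x%:C) ^+ k) @ \oo --> cis x.
Proof.
have -> : (fun n => \sum_(0 <= k < n) (k`!%:R : R[i])^-1 * ('i * x%:C) ^+ k) =
   (fun n => (series (cos_coeff x) n)%:C + 'i * (series (sin_coeff x) n)%:C).
  apply/funext => n; rewrite /series /= !rmorph_sum mulr_sumr -big_split.
  apply: eq_bigr => k _ /=.
  have i2 m : 'i ^+ m.*2 = ((-1) ^+ m)%:C :> R[i].
    by rewrite -muln2 mulnC exprM sqr_i rmorphXn rmorphN1.
  have -> : (k`!%:R : R[i])^-1 = (k`!%:R^-1 : R)%:C by rewrite fmorphV rmorph_nat.
  rewrite exprMn -rmorphXn /= /cos_coeff /sin_coeff /=.
  have := odd_double_half k; case: (odd k) => /= kE.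
    have -> : k.-1./2 = k./2 by rewrite -[in LHS]kE /= doubleK.
    rewrite -[X in 'i ^+ X]kE add1n exprS i2.
    rewrite !mul0r mul1r rmorph0 add0r !rmorphM /=; ring.
  rewrite -[X in 'i ^+ X]kE add0n i2 !mul0r mul1r rmorph0 mulr0 addr0 !rmorphM /=; ring.
have -> : cis x = (cos x)%:C + 'i * (sin x)%:C.
  by apply/eqP; rewrite eq_complex /=; apply/andP; split; apply/eqP; ring.
have cosl : series (cos_coeff x) @ \oo --> cos x.
  by rewrite cos.unlock; exact: is_cvg_series_cos_coeff.
have sinl : series (sin_coeff x) @ \oo --> sin x.
  by rewrite sin.unlock; exact: is_cvg_series_sin_coeff.
have cl := cvg_real_complex cosl.
have sl := cvgMl_tmp (a := ('i : R[i])) (cvg_real_complex sinl).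
exact: (cvgD cl (sl _)).
Qed.

Lemma conj_mx_exp (K : comUnitRingType) n (P D : 'M[K]_n) k : P \in unitmx ->
  (invmx P *m D *m P) ^+ k = invmx P *m (D ^+ k) *m P.
Proof.
move=> uP; elim: k => [|k IHk]; first by rewrite !expr0 mulmx1 mulVmx.
by rewrite exprS IHk exprS -!mulmxE !mulmxA mulmxK.
Qed.

Lemma diag_mx_exp (K : comNzRingType) n (d : 'rV[K]_n) k :
  diag_mx d ^+ k = diag_mx (\row_j d 0 j ^+ k).
Proof.
elim: k => [|k IHk].
  by rewrite expr0; apply/matrixP => i j; rewrite !mxE.
rewrite exprS IHk -mulmxE mulmx_diag; congr diag_mx.
by apply/rowP => j; rewrite !mxE exprS.
Qed.

Lemma expmx_diagonalized (R : realType) n (P : 'M[R[i]]_n) (theta : 'I_n -> R) (t : R) :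
    P \in unitmx ->
  expmx (('i * t%:C) *: (invmx P *m diag_mx (\row_j (theta j)%:C) *m P)) =
    invmx P *m diag_mx (\row_j cis (theta j * t)) *m P.
Proof.
move=> uP; rewrite /expmx; apply: cvg_lim; first exact: norm_hausdorff.
apply: cvg_mx_entries => a b.
have -> : (fun m => series (fun k => (k`!%:R : R[i])^-1 *:
     (('i * t%:C) *: (invmx P *m diag_mx (\row_j (theta j)%:C) *m P)) ^+ k) m a b) =
  (fun m => \sum_j (invmx P a j * P j b) *
      (\sum_(0 <= k < m) (k`!%:R : R[i])^-1 * ('i * (theta j * t)%:C) ^+ k)).
  apply/funext => m; rewrite /series /= summxE.
  under [RHS]eq_bigr do rewrite mulr_sumr.
  rewrite exchange_big; apply: eq_bigr => k _ /=.
  rewrite [_ *: (_ *m _ *m _)]scalemxAl scalemxAr conj_mx_exp //.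
  rewrite -[_ *: diag_mx _]linearZ /= diag_mx_exp mul_mx_diag mxE mxE.
  rewrite mulr_sumr; apply: eq_bigr => j _; rewrite !mxE.
  have -> : 'i * t%:C * (theta j)%:C = 'i * (theta j * t)%:C.
    by rewrite rmorphM /= -mulrA [t%:C * _]mulrC.
  rewrite [LHS]mulrCA -!mulrA; congr (_ * _).
  by rewrite mulrCA [RHS]mulrCA [P j b * _]mulrC.
have -> : (invmx P *m diag_mx (\row_j cis (theta j * t)) *m P) a b =
   \sum_j (invmx P a j * P j b) * cis (theta j * t).
  rewrite mxE; apply: eq_bigr => j _.
  rewrite mul_mx_diag !mxE; ring.
apply: cvg_sum_complex => j.
have sl := cvgMl_tmp (a := invmx P a j * P j b) (@exp_series_cis R (theta j * t)).
exact: (sl _).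
Qed.

Lemma cvg_cis (R : realType) (x : nat -> R) (a : R) :
  (forall n, 1 - cos (x n - a) < n.+1%:R^-1) -> (fun n => cis (x n)) @ \oo --> cis a.
Proof.
move=> xa; apply/cvgrPdist_lt => e e0.
have eE : e = (complex.Re e)%:C by rewrite RRe_real // gtr0_real.
have re0 : 0 < complex.Re e by rewrite -ltcR -eE.
have h0 : 0 < complex.Re e ^+ 2 / 2 by rewrite divr_gt0 ?exprn_gt0.
apply: filterS (near_infty_natSinv_lt (PosNum h0)) => n /= lt_n.
rewrite eE normc_def ltcR.
have -> : complex.Re (cis a - cis (x n)) ^+ 2 + complex.Im (cis a - cis (x n)) ^+ 2 =
   2 * (1 - cos (x n - a)).
  rewrite /= cosB; have := cos2Dsin2 a; have := cos2Dsin2 (x n); nra.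
rewrite -[ltRHS](gtr0_norm re0) -sqrtr_sqr ltr_sqrt ?exprn_gt0 //.
by have := lt_trans (xa n) lt_n; rewrite ltr_pdivlMr // mulrC.
Qed.

Lemma mul_diag_entry (C : comNzRingType) n (A B : 'M[C]_n) (d : 'rV[C]_n) a b :
  (A *m diag_mx d *m B) a b = \sum_j (A a j * B j b) * d 0 j.
Proof. by rewrite mxE; apply: eq_bigr => j _; rewrite mul_mx_diag !mxE mulrAC. Qed.

(** The eigenvalues outside [J] do not contribute to the [K x K] block.  On the
    others, Kronecker's theorem provides times at which the phases converge to
    the prescribed ones. *)
Lemma closure_evolution (R : realType) (V : finType) (K : {set V}) (N : 'M[R]_#|V|)
    (P : 'M[R[i]]_#|V|) (theta alpha : 'I_#|V| -> R) (J : pred 'I_#|V|) :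
    P \in unitmx ->
    map_mx (real_complex R) N = invmx P *m diag_mx (\row_j (theta j)%:C) *m P ->
    (forall v j, v \in K -> ~~ J j -> invmx P (enum_rank v) j = 0) ->
    (forall l : {j | J j} -> int, \sum_i theta (val i) *~ l i = 0 ->
       \sum_i alpha (val i) *~ l i = 0) ->
  closure [set principal_submx K (expmx (('i * t%:C) *: map_mx (real_complex R) N))
             | t in [set t : R | 0 <= t]]
    (principal_submx K
       (invmx P *m diag_mx (\row_j (if J j then cis (alpha j) else 0)) *m P)).
Proof.
move=> uP NE J0 rel.
have /choice[t tP] : forall n : nat, exists t : R, 0 <= t /\
    forall i : {j | J j}, 1 - cos (theta (val i) * t - alpha (val i)) < n.+1%:R^-1.
  move=> n; have n0 : 0 < n.+1%:R^-1 :> R by rewrite invr_gt0.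
  by have [t t0 tP] := kronecker rel n0; exists t.
pose X n := principal_submx K (expmx (('i * (t n)%:C) *: map_mx (real_complex R) N)).
have cvgX : X @ \oo --> principal_submx K
       (invmx P *m diag_mx (\row_j (if J j then cis (alpha j) else 0)) *m P).
  apply: cvg_mx_entries => a b; rewrite mxE mul_diag_entry.
  have -> : (fun n => X n a b) = (fun n => \sum_j
     (invmx P (enum_rank (enum_val a)) j * P j (enum_rank (enum_val b))) * cis (theta j * t n)).
    apply/funext => n; rewrite mxE NE expmx_diagonalized // mul_diag_entry.
    by apply: eq_bigr => j _; rewrite mxE.
  apply: cvg_sum_complex => j; rewrite mxE.
  have [Jj|nJ] := boolP (J j); last first.
    rewrite (J0 _ _ (enum_valP a) nJ) !mul0r.
    under eq_fun do rewrite mul0r.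
    exact: cvg_cst.
  have cj : (fun n => cis (theta j * t n)) @ \oo --> cis (alpha j).
    by apply: cvg_cis => n; exact: (tP n).2 (exist _ j Jj).
  have := cvgMl_tmp (a := invmx P (enum_rank (enum_val a)) j * P j (enum_rank (enum_val b))) cj.
  by apply.
move=> B /cvgX nB.
have {}nB : \forall n \near \oo, B (X n) := nB.
have [n Bn] := filter_ex nB.
by exists (X n); split=> //; exists (t n) => //; exact: (tP n).1.
Qed.

Lemma real_symmetric_diagonalization (R : realType) n (N : 'M[R]_n) : N^T = N ->
  exists (P : 'M[R[i]]_n) (theta : 'I_n -> R), P \in unitmx /\
    map_mx (real_complex R) N = invmx P *m diag_mx (\row_j real_complex R (theta j)) *m P.
Proof.
move=> symN; set A := map_mx _ N.
have hA : A \is hermsymmx.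
  apply: realsym_hermsym.
    apply/is_hermitianmxP; by rewrite expr0 scale1r map_mx_id // /A map_trmx symN.
  apply/mxOverP => i j; rewrite mxE; apply/complex_realP; by exists (N i j).
have nA := hermitian_normalmx hA.
exists (spectralmx A), (fun j => complex.Re (spectral_diag A 0 j)); split.
  exact: spectral_unit.
rewrite {1}(orthomx_spectralP nA); congr (_ *m diag_mx _ *m _).
apply/rowP => j; rewrite mxE RRe_real //.
by move/mxOverP: (hermitian_spectral_diag_real hA); apply.
Qed.

End Evolution.

(** * Fractional revival on an orbit *)

Lemma sum_over_support (C : pzSemiRingType) (V : finType) (K : {set V})
    (y : 'rV[C]_#|V|) (f : 'I_#|V| -> C) :
    (forall v, v \notin K -> y 0 (enum_rank v) = 0) ->
  \sum_(b < #|K|) y 0 (enum_rank (enum_val b)) * f (enum_rank (enum_val b)) =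
    \sum_i y 0 i * f i.
Proof.
move=> y0.
transitivity (\sum_(v in K) y 0 (enum_rank v) * f (enum_rank v)).
  by rewrite [RHS]big_enum_val.
rewrite [RHS](reindex_onto enum_rank enum_val) => [|i _]; last exact: enum_valK.
rewrite big_mkcond; apply: eq_big => [v|v _]; first by rewrite enum_rankK eqxx.
by case: ifPn => // vK; rewrite y0 ?mul0r.
Qed.

(** Up to scaling, [E] is unitary, so [U] is unitarily similar to [diag_mx c]. *)
Lemma fourier_conjugate_unitary (C : numClosedFieldType) r (E U : 'M[C]_r) (c : 'rV[C]_r) :
    (0 < r)%N -> E *m (map_mx Num.conj E^T) = r%:R%:M ->
    E *m U = diag_mx c *m E -> (forall k, c 0 k * Num.conj (c 0 k) = 1) ->
  U \is unitarymx.
Proof.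
move=> r0 EG EU cc; set G := map_mx _ _ in EG.
have rr : (r%:R : C) != 0 by rewrite pnatr_eq0 -lt0n.
have GE : G *m E = r%:R%:M.
  have E1 : E *m (r%:R^-1 *: G) = 1%:M by rewrite -scalemxAr EG scale_scalar_mx mulVf.
  by have := mulmx1C E1; rewrite -scalemxAl => /(canRL (scalerK _))->;
     rewrite ?invrK ?scale_scalar_mx ?mulr1 // invr_eq0.
have UE : U = r%:R^-1 *: (G *m diag_mx c *m E).
  by rewrite -mulmxA -EU mulmxA GE mul_scalar_mx scalerA mulVf // scale1r.
apply/unitarymxP.
have -> : map_mx Num.conj U^T = r%:R^-1 *: (G *m diag_mx (map_mx Num.conj c) *m E).
  rewrite [in LHS]UE linearZ /= map_mxZ fmorphV rmorph_nat !trmx_mul !map_mxM.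
  rewrite tr_diag_mx map_diag_mx -/G mulmxA; congr (_ *: (_ *m _ *m _)).
  by rewrite /G -map_trmx trmxK -map_mx_comp map_mx_id // => x; apply: conjCK.
rewrite UE -scalemxAl -scalemxAr scalerA.
have -> : G *m diag_mx c *m E *m (G *m diag_mx (map_mx Num.conj c) *m E) =
    r%:R *: (G *m (diag_mx c *m diag_mx (map_mx Num.conj c)) *m E).
  rewrite -!mulmxA (mulmxA E) EG mul_scalar_mx -!scalemxAr //.
have -> : diag_mx c *m diag_mx (map_mx Num.conj c) = 1%:M.
  rewrite mulmx_diag -diag_const_mx; congr diag_mx; apply/rowP => k.
  by rewrite !mxE cc.
by rewrite mulmx1 GE scalerA scale_scalar_mx divfK // mulVf.
Qed.

(** The walk bound applies to [y_0], the indicator of the orbit, and the dimension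
    count to some other character. *)
Lemma exists_unequal_degrees (V : finType) (e : rel V) (T : {perm V}) (x0 : V)
    (F : fieldType) (w : F) d (p : 'I_#|porbit T x0| -> {poly F})
    (m : 'I_#|porbit T x0| -> nat) :
    [pchar F] =i pred0 -> automorphism e T -> (#|porbit T x0|).-primitive_root w ->
    largest_dist e (porbit T x0) d -> (#|V| < #|porbit T x0| * d.+1)%N ->
    (forall k : 'I_#|porbit T x0|,
      minimal_annihilator (adjacency_mx e F) (orbit_character T x0 w k) (p k) (m k)) ->
  exists k0 k1, (m k1 < m k0)%N.
Proof.
move=> charF T_aut w_prim dist lt_V pP.
pose k0 := Ordinal (orbit_gt0 T x0); exists k0.
have [k [g [nz_g sg g0]]] := exists_low_degree_annihilator T_aut w_prim lt_V.
exists k; apply: (@leq_trans d).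
  have [_ sp _ min] := pP k; rewrite -ltnS -[(m k).+2]sp.
  rewrite (leq_trans _ sg) // leqNgt; apply/negP => lt_g.
  by rewrite (min g g0 lt_g) eqxx in nz_g.
have [mon sp p0 _] := pP k0; rewrite -2!ltnS -[(m _).+2]sp.
apply: (indicator_annihilator_size charF _ dist (monic_neq0 mon) p0) => v.
have [vK|vK] := boolP (v \in porbit T x0); last exact: orbit_character_out.
by have /(orbit_iterP T x0)[a ->] := vK; rewrite (orbit_characterE w_prim) mul0n.
Qed.

Section FourierMatrix.
Variables (V : finType) (T : {perm V}) (x0 : V) (F : fieldType) (w : F).
Variables (C : numClosedFieldType) (iota : {rmorphism F -> C}).
Let r := #|porbit T x0|.
Hypothesis w_prim : r.-primitive_root w.

(** The discrete Fourier matrix with permuted columns: they follow the enumeration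
    of the orbit instead of the powers of [T]. *)
Definition fourier_mx : 'M[C]_r :=
  \matrix_(k, b) map_mx iota (orbit_character T x0 w k) 0 (enum_rank (enum_val b)).

(** The embedded root of unity has modulus [1]. *)
Lemma conj_root_of_unity n : Num.conj (iota (w ^+ n)) = iota (w ^- n).
Proof.
have r_gt0 : (0 < r)%N := orbit_gt0 T x0.
have w0 : w != 0 by rewrite (prim_root_eq0 w_prim) -lt0n.
have nw : `|iota w| = 1.
  apply/eqP; rewrite -(@pexpr_eq1 _ _ r) ?normr_ge0 // -normrX -rmorphXn.
  by rewrite (prim_expr_order w_prim) rmorph1 normr1.
rewrite fmorphV; apply: (mulfI (x := iota (w ^+ n))).
  by rewrite fmorph_eq0 expf_neq0.
by rewrite divff ?fmorph_eq0 ?expf_neq0 // -normCK rmorphXn normrX nw !expr1n.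
Qed.

Lemma fourier_mx_adjoint : fourier_mx *m map_mx Num.conj fourier_mx^T = r%:R%:M.
Proof.
apply/matrixP => k l; rewrite mxE [RHS]mxE.
pose y (k : 'I_r) := orbit_character T x0 w k.
pose f v := iota ((y k) 0 (enum_rank v)) * Num.conj (iota ((y l) 0 (enum_rank v))).
transitivity (\sum_(b < #|porbit T x0|) f (enum_val b)).
  apply: eq_bigr => b _; rewrite [map_mx _ _ b l]mxE [_^T b l]mxE /f.
  by rewrite ![fourier_mx _ b]mxE ![map_mx iota _ _ _]mxE.
rewrite sum_orbit (eq_bigr (fun a : 'I_r => iota ((w ^+ k / w ^+ l) ^+ a))).
  rewrite -rmorph_sum sum_root_orthogonal //.
  by case: eqP => _; rewrite ?rmorph_nat ?rmorph0.
move=> a _; rewrite /f !orbit_characterE // conj_root_of_unity -rmorphM.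
by rewrite expr_div_n -!exprM.
Qed.

Lemma fourier_mx_unit : fourier_mx \in unitmx.
Proof.
have /mulmx1_unit[] // :
    fourier_mx *m (r%:R^-1 *: map_mx Num.conj fourier_mx^T) = 1%:M.
rewrite -scalemxAr fourier_mx_adjoint scale_scalar_mx mulVf // pnatr_eq0 -lt0n.
exact: orbit_gt0.
Qed.

Lemma fourier_mx_sum k (f : 'I_#|V| -> C) :
  \sum_(b < r) fourier_mx k b * f (enum_rank (enum_val b)) =
    \sum_i map_mx iota (orbit_character T x0 w k) 0 i * f i.
Proof.
rewrite -(@sum_over_support _ _ (porbit T x0)).
  by apply: eq_bigr => b _; rewrite [fourier_mx k b]mxE.
by move=> v vK; rewrite mxE orbit_character_out ?rmorph0.
Qed.

Lemma fourier_mx_base k : exists b, fourier_mx k b = 1.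
Proof.
have x0K : x0 \in porbit T x0 := porbit_id T x0.
exists (enum_rank_in x0K x0); rewrite mxE mxE enum_rankK_in //.
by rewrite orbit_character_base // rmorph1.
Qed.
End FourierMatrix.

Lemma pencil_over_subfield (R : realType) (V : finType) (e : rel V) (K : {set V})
    (Q : R) (F : fieldType) (iota : {rmorphism F -> R[i]}) :
  map_mx (real_complex R) (adjmx R e + Q *: Dmx R K) =
    map_mx iota (adjacency_mx e F) + real_complex R Q *: map_mx iota (support_mx F K).
Proof.
apply/matrixP => i j; rewrite !mxE rmorphD rmorphM /= !rmorph_nat !rmorphMn /=.
by rewrite !rmorph1.
Qed.

Lemma pencil_symmetric (R : realType) (V : finType) (e : rel V) (K : {set V}) (Q : R) :
  symmetric e -> (adjmx R e + Q *: Dmx R K)^T = adjmx R e + Q *: Dmx R K.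
Proof.
move=> e_sym; apply/matrixP => i j; rewrite !mxE e_sym eq_sym; congr (_ + _ * _).
by case: eqVneq => [->|].
Qed.

Lemma left_eigenvector_diagonalized (C : fieldType) n (P : 'M[C]_n) (u y : 'rV[C]_n) c :
    P \in unitmx -> (forall j, (y *m invmx P) 0 j != 0 -> u 0 j = c) ->
  y *m (invmx P *m diag_mx u *m P) = c *: y.
Proof.
move=> uP uc; rewrite !mulmxA.
have -> : y *m invmx P *m diag_mx u = c *: (y *m invmx P).
  apply/rowP => j; rewrite mul_mx_diag [LHS]mxE [RHS]mxE mulrC.
  by have [->|/uc ->] := eqVneq ((y *m invmx P) 0 j) 0; rewrite ?mulr0.
by rewrite -scalemxAl mulmxKV.
Qed.

Lemma right_eigenvector_diagonalized (C : fieldType) n (P : 'M[C]_n) (u : 'rV[C]_n) j :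
  P \in unitmx -> (invmx P *m diag_mx u *m P) *m col j (invmx P) = u 0 j *: col j (invmx P).
Proof.
move=> uP; rewrite colE !mulmxA mulmxK // -!mulmxA scalemxAr; congr (_ *m _).
rewrite mul_diag_mx; apply/colP => i; rewrite !mxE eqxx andbT.
by case: eqVneq => [->|_]; rewrite ?mulr0.
Qed.

(** The angles lie in the interval from [0] to [pi], where cosine is injective. *)
Lemma cis_inv_succ_inj (R : realType) (a b : nat) :
  cis (a.+1%:R^-1 : R) = cis b.+1%:R^-1 -> a = b.
Proof.
have bound k : k.+1%:R^-1 \in `[0, pi : R].
  have inv1 : k.+1%:R^-1 <= 1 :> R by rewrite invf_le1 ?ltr0n ?ler1n.
  rewrite in_itv /= invr_ge0 ler0n /= (le_trans inv1) // (le_trans _ (pi_ge2 R)) //.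
  by rewrite ler1n.
move=> [/(cos_inj (bound a) (bound b)) ab _].
by move/invr_inj/eqP: ab; rewrite eqr_nat eqSS => /eqP.
Qed.

Theorem theorem4p6 (R : realType) (V : finType) (e : rel V)
    (e_sym : symmetric e) (e_irr : irreflexive e)
    (T : {perm V}) (T_aut : automorphism e T)
    (r : nat) (T_order : #[T]%g = r)
    (K : {set V}) (K_orbit : K \in porbits T) (K_card : #|K| = r)
    (d : nat) (K_dist : largest_dist e K d)
    (rd : (#|V| < r * d.+1)%N)
    (Q : R) (Q_tr : transcendental Q) :
  pretty_good_fractional_revival (adjmx R e + Q *: Dmx R K) K.
Proof.
case/imsetP: K_orbit => x0 _ KE; subst K; rewrite -{}K_card in rd; clear r T_order.
have r_gt0 := orbit_gt0 T x0; set r := #|porbit T x0| in rd r_gt0 *.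
have [F [iota [F_closed F_alg F_tr]]] := exists_algebraic_numbers R.
have [w w_prim] := exists_algebraic_root_of_unity r_gt0 F_alg.
have QC_tr := F_tr Q Q_tr; set QC : R[i] := real_complex R Q in QC_tr.
have charF : [pchar F] =i pred0 by move=> x; rewrite -(fmorph_pchar iota) pchar_num.
set A := adjacency_mx e F; set D := support_mx F (porbit T x0).
pose y (k : 'I_r) := orbit_character T x0 w k.
have yW k : rank_one_cyclic A D (enum_rank x0) (y k).
  exact: (@orbit_character_rank_one V e T x0 F w _ iota k e_sym T_aut w_prim).
have /fin_all_exists[pm pmP] : forall k, exists pm : {poly F} * nat,
    minimal_annihilator A (y k) pm.1 pm.2.
  by move=> k; apply: exists_minimal_annihilator; apply: rank_one_cyclic_neq0 (yW k).
pose m k := (pm k).2.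
have [k0 [k1 mlt]] : exists k0 k1, (m k1 < m k0)%N.
  exact: (exists_unequal_degrees charF T_aut w_prim K_dist rd pmP).
have [P [theta [uP NE]]] := real_symmetric_diagonalization (pencil_symmetric (porbit T x0) Q e_sym).
(* the component of [y k] along the [j]-th eigenvector *)
pose ov k j := (map_mx iota (y k) *m invmx P) 0 j.
pose J j := [exists k, ov k j != 0].
have eig k j : ov k j != 0 -> visible_eigenvalue iota QC A D (y k) (real_complex R (theta j)).
  move=> nz; exists (col j (invmx P)).
    by rewrite -pencil_over_subfield NE right_eigenvector_diagonalized // mxE.
  apply: contraNneq nz => ov0; rewrite /ov.
  have -> : (map_mx iota (y k) *m invmx P) 0 j = (map_mx iota (y k) *m col j (invmx P)) 0 0.
    by rewrite colE mulmxA -colE [RHS]mxE.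
  by rewrite ov0 mxE.
have /fin_all_exists[ka kaP] : forall j, exists k, J j -> ov k j != 0.
  move=> j; have [/existsP[k kj]|nJ] := boolP (J j); first by exists k.
  by exists k0.
(* by [eigenvalue_relation] these phases obey every relation of the eigenvalues *)
pose alpha j : R := (m (ka j)).+1%:R^-1.
have m_unique k j : ov k j != 0 -> m k = m (ka j).
  move=> nz; have Jj : J j by apply/existsP; exists k.
  exact: (eigenvalue_degree_unique QC_tr F_closed (yW k) (pmP k) (yW (ka j))
    (pmP (ka j)) (eig _ _ nz) (eig _ _ (kaP _ Jj))).
pose c k : R[i] := cis ((m k).+1%:R^-1).
pose W := invmx P *m diag_mx (\row_j (if J j then cis (alpha j) else 0)) *m P.
have yWm k : map_mx iota (y k) *m W = c k *: map_mx iota (y k).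
  apply: left_eigenvector_diagonalized => // j nz; rewrite mxE.
  have -> : J j by apply/existsP; exists k.
  by rewrite /alpha -(m_unique k j nz).
pose E := fourier_mx T x0 w iota.
have EU : E *m principal_submx (porbit T x0) W = diag_mx (\row_k c k) *m E.
  apply/matrixP => k b; rewrite mul_diag_mx mxE [RHS]mxE [in RHS]mxE [E k b]mxE.
  move/rowP: (yWm k) => /(_ (enum_rank (enum_val b))); rewrite [LHS]mxE [RHS]mxE => <-.
  rewrite -(fourier_mx_sum w iota k (fun i => W i (enum_rank (enum_val b)))).
  by apply: eq_bigr => a _; rewrite [principal_submx _ _ a b]mxE.
exists (principal_submx (porbit T x0) W); split.
- apply: (closure_evolution (alpha := alpha) (J := J) uP NE).
    move=> v j vK; rewrite negb_exists => /forallP nJ.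
    (* the [y k] span the functions on the orbit, and none of them sees [j] *)
    pose x : 'cV_r := \col_(b < #|porbit T x0|) invmx P (enum_rank (enum_val b)) j.
    have Ex0 : E *m x = 0.
      apply/matrixP => k i; rewrite mxE [RHS]mxE.
      have /eqP ov0 : ov k j == 0 by have := nJ k; rewrite negbK.
      rewrite -[RHS]ov0 /ov [RHS]mxE -(fourier_mx_sum w iota k (fun i => invmx P i j)).
      by apply: eq_bigr => b _; rewrite [x b i]mxE.
    have : x = 0 by rewrite -(mulKmx (fourier_mx_unit iota w_prim) x) Ex0 mulmx0.
    move/colP => /(_ (enum_rank_in vK v)).
    by rewrite !mxE enum_rankK_in.
  move=> l rel; apply: (fmorph_inj (real_complex R)).
  have relC : \sum_i real_complex R (theta (val i)) *~ l i = 0.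
    rewrite -[RHS](rmorph0 (real_complex R)) -[in RHS]rel rmorph_sum.
    by apply: eq_bigr => i _; rewrite rmorphMz.
  have := eigenvalue_relation QC_tr F_closed charF (fun i => yW (ka (val i)))
     (fun i => pmP (ka (val i))) (fun i => eig _ _ (kaP _ (valP i))) relC.
  rewrite rmorph0 => <-; rewrite rmorph_sum; apply: eq_bigr => i _.
  by rewrite rmorphMz /= fmorphV rmorph_nat.
- apply: (fourier_conjugate_unitary r_gt0 (fourier_mx_adjoint iota w_prim) EU) => k.
  by rewrite mxE; exact: cis_unit.
(* a scalar matrix would have all the eigenvalues [c k] equal *)
apply/negP => /is_scalar_mxP[s Us].
have cs k : c k = s.
  have [b Ekb] := fourier_mx_base iota w_prim k; move/matrixP: EU => /(_ k b).
  by rewrite Us mul_mx_scalar mul_diag_mx [LHS]mxE [RHS]mxE Ekb !mulr1 mxE => ->.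
have mE : m k0 = m k1 by apply: (@cis_inv_succ_inj R); exact: etrans (cs k0) (esym (cs k1)).
by rewrite mE ltnn in mlt.
Qed.
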